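(* Let $(M,\Omega)$ be a symplectic manifold and let $\phi:N\to M$ be a smooth symplectic map. Let $\nabla$ be a symplectic connection on $(M,\Omega)$ and let $\bar\nabla$ be the symplectic connection on $(N,\phi^*(\Omega))$ induced by $\nabla$ and $\phi$, and let $\Pi$ be the second fundamental form of $\phi$ with respect to $\nabla$ and $\bar\nabla$. For a two-dimensional symplectic subspace $L\subset T_pN$, the symplectic curvature quadratic forms $\mathscr{K}^{N,\bar\nabla}_{p,L}$ of $\bar\nabla$ and $\mathscr{K}^{M,\nabla}_{\phi(p),T\phi(p)(L)}$ of $\nabla$ are related by $$\mathscr{K}^{M,\nabla}_{\phi(p),T\phi(p)(L)}(T\phi(p)(Z))=\mathscr{K}^{N,\bar\nabla}_{p,L}(Z)+\frac{2\,\Omega(\Pi(X,Z),\Pi(Y,Z))}{\phi^*(\Omega)(X,Y)},$$ where $X$ and $Y$ span $L$ and $Z\in L$.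
   Context: A connection on a symplectic manifold $(M,\Omega)$ is symplectic if it is torsion-free and $\nabla\Omega=0$; its curvature is $R(X,Y)Z=\nabla_X\nabla_YZ-\nabla_Y\nabla_XZ-\nabla_{[X,Y]}Z$. A two-dimensional subspace $L\subset T_pM$ is symplectic if $\Omega|_L$ is nondegenerate; its symplectic curvature quadratic form is $\mathscr{K}_{p,L}(Z)=\Omega(R(X,Y)Z,Z)/\Omega(X,Y)$ for any basis $X,Y$ of $L$ (independent of the choice). A smooth map $\phi:N\to M$ is symplectic if $\phi^*(\Omega)$ is a symplectic form on $N$ (so $\phi$ is an immersion). The pullback bundle splits as $\phi^*TM=\phi_*(TN)\oplus\phi_*(TN)^\perp$, where $\phi_*(TN)$ has fibers $T\phi(p)(T_pN)$ and $\perp$ is the $\Omega$-orthogonal complement. For vector fields $X,Y$ on $N$, with $\nabla$ also denoting the connection induced on $\phi^*TM$, the induced connection $\bar\nabla$ on $N$ is defined by requiring $T\phi(\bar\nabla_XY)$ to be the projection of $\nabla_XT\phi(Y)$ on $\phi_*(TN)$ along $\phi_*(TN)^\perp$; it is torsion-free and preserves $\phi^*(\Omega)$. The second fundamental form is $\Pi(X,Y)=\nabla_XT\phi(Y)-T\phi(\bar\nabla_XY)$, a symmetric $\phi^*TM$-valued tensor on $N$ (here with values in $\phi_*(TN)^\perp$). *)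

(* Defs.v *)
(* MathComp-Analysis; all manifolds are C^oo, Hausdorff, second countable and
   of constant finite dimension, over an abstract R : realType. *)
From mathcomp Require Import all_boot all_order all_algebra.
From mathcomp Require Import all_classical all_reals all_analysis.

Set Implicit Arguments.
Unset Strict Implicit.
Unset Printing Implicit Defensive.

Import Order.TTheory GRing.Theory Num.Theory.
Import numFieldNormedType.Exports.

Local Open Scope classical_set_scope.
Local Open Scope ring_scope.

(* Meaningful for U open, since differentiability at a point of U looks at a
   full neighbourhood of that point. *)
Fixpoint Ck_on (R : realType) (V W : normedModType R) (k : nat) (U : set V)
    (f : V -> W) : Prop :=
  match k with
  | 0 => forall x, U x -> {for x, continuous f}
  | k'.+1 => (forall x, U x -> differentiable f x) /\
             (forall v, Ck_on k' U ('D_v f))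
  end.

Definition smooth_on (R : realType) (V W : normedModType R) (U : set V)
    (f : V -> W) : Prop := forall k, Ck_on k U f.

(* The values of [chart_map] off [chart_dom], and of [chart_inv] off
   [chart_im], are irrelevant. *)
Record chart (R : realType) (n : nat) (T : topologicalType) := Chart {
  chart_dom : set T;
  chart_map : T -> 'rV[R]_n;
  chart_inv : 'rV[R]_n -> T }.

Definition chart_im (R : realType) n (T : topologicalType) (c : chart R n T) :=
  chart_map c @` chart_dom c.

Definition is_chart (R : realType) n (T : topologicalType) (c : chart R n T) :=
  [/\ open (chart_dom c), open (chart_im c),
      (forall p, chart_dom c p -> chart_inv c (chart_map c p) = p),
      (forall p, chart_dom c p -> {for p, continuous (chart_map c)}) &
      (forall x, chart_im c x -> {for x, continuous (chart_inv c)})].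

Record manifold (R : realType) (n : nat) := Manifold {
  carrier :> topologicalType;
  atlas : set (chart R n carrier);
  manifold_hausdorff : hausdorff_space carrier;
  manifold_second_countable : @second_countable carrier;
  manifold_chart : forall c, atlas c -> is_chart c;
  manifold_cover : forall p : carrier, exists2 c, atlas c & chart_dom c p;
  manifold_compat : forall c d, atlas c -> atlas d ->
    smooth_on (chart_map c @` (chart_dom c `&` chart_dom d))
              (chart_map d \o chart_inv c) }.

Definition smooth_fun (R : realType) n (M : manifold R n) (f : M -> R) :=
  forall c, atlas c ->
    smooth_on (chart_im c) (f \o chart_inv c : 'rV[R]_n -> R^o).

Definition smooth_map (R : realType) m n (N : manifold R n) (M : manifold R m)
    (phi : N -> M) : Prop :=
  continuous phi /\
  forall (c : chart R n N) (d : chart R m M), atlas c -> atlas d ->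
    smooth_on (chart_map c @` (chart_dom c `&` phi @^-1` chart_dom d))
              (chart_map d \o phi \o chart_inv c).

(* Tangent vectors act on smooth functions.  To make Leibniz equality of
   operators mean equality on smooth functions, they are all extended by 0 to
   the functions which are not smooth. *)
Definition operator (R : realType) n (M : manifold R n) := (M -> R) -> R^o.

(* The operator f |-> \sum_i w_i (\partial f / \partial x^i)(p). *)
Definition chart_vector (R : realType) n (M : manifold R n) (c : chart R n M)
    (w : 'rV[R]_n) (p : M) : operator M := fun f =>
  if `[< smooth_fun f >]
  then 'D_w (f \o chart_inv c : 'rV[R]_n -> R^o) (chart_map c p) else 0.

Definition tangent (R : realType) n (M : manifold R n) (p : M) :
    set (operator M) :=
  [set v | exists c : chart R n M,
     [/\ atlas c, chart_dom c p & exists w, v = chart_vector c w p]].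

Definition tangent_map (R : realType) m n (N : manifold R n)
    (M : manifold R m) (phi : N -> M) (v : operator N) : operator M := fun f =>
  if `[< smooth_fun f >] then v (f \o phi) else 0.

(* Smooth sections of the pullback bundle phi^*TM. *)
Definition section (R : realType) m n (N : manifold R n) (M : manifold R m)
    (phi : N -> M) : set (N -> operator M) :=
  [set V | (forall p, tangent (phi p) (V p)) /\
           (forall f, smooth_fun f -> smooth_fun (fun p => V p f : R))].

Definition vfield (R : realType) n (M : manifold R n) :
    set (M -> operator M) := section (fun p : M => p).

Definition bracket (R : realType) n (M : manifold R n)
    (X Y : M -> operator M) : M -> operator M := fun p f =>
  X p (fun q => Y q f) - Y p (fun q => X q f).

(* A vector field through a given tangent vector, used to evaluate at tangent
   vectors an expression in vector fields whose value at p depends only on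
   their values at p. *)
Definition extension (R : realType) n (M : manifold R n) (p : M)
    (v : operator M) : M -> operator M :=
  xget (fun _ => 0) [set X | vfield X /\ X p = v].

(* Only the values of a form at (p, u, v) with u, v tangent at p matter. *)
Definition form2 (R : realType) n (M : manifold R n) :=
  M -> operator M -> operator M -> R.

Definition nondegenerate_on (R : realType) n (M : manifold R n)
    (E : set (operator M)) (w : operator M -> operator M -> R) : Prop :=
  forall u, E u -> (forall v, E v -> w u v = 0) -> u = 0.

Definition is_form2 (R : realType) n (M : manifold R n) (Om : form2 M) : Prop :=
  [/\ (forall p (a : R) u u' v,
         tangent p u -> tangent p u' -> tangent p v ->
         Om p (a *: u + u') v = a * Om p u v + Om p u' v),
      (forall p u v, tangent p u -> tangent p v -> Om p u v = - Om p v u) &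
      (forall X Y, vfield X -> vfield Y ->
         smooth_fun (fun p => Om p (X p) (Y p)))].

(* The exterior derivative, by the invariant formula. *)
Definition dform2 (R : realType) n (M : manifold R n) (Om : form2 M)
    (X Y Z : M -> operator M) (p : M) : R :=
  X p (fun q => Om q (Y q) (Z q)) - Y p (fun q => Om q (X q) (Z q))
  + Z p (fun q => Om q (X q) (Y q))
  - Om p (bracket X Y p) (Z p) + Om p (bracket X Z p) (Y p)
  - Om p (bracket Y Z p) (X p).

Definition symplectic_form (R : realType) n (M : manifold R n)
    (Om : form2 M) : Prop :=
  [/\ is_form2 Om,
      (forall p, nondegenerate_on (tangent p) (Om p)) &
      (forall X Y Z p, vfield X -> vfield Y -> vfield Z ->
         dform2 Om X Y Z p = 0)].

Definition pullback_form (R : realType) m n (N : manifold R n)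
    (M : manifold R m) (phi : N -> M) (Om : form2 M) : form2 N := fun p u v =>
  Om (phi p) (tangent_map phi u) (tangent_map phi v).

(* Connections on the vector bundle phi^*TM over N. *)
Definition connection_along (R : realType) m n (N : manifold R n)
    (M : manifold R m) (phi : N -> M)
    (D : (N -> operator N) -> (N -> operator M) -> (N -> operator M)) : Prop :=
  [/\ (forall X V, vfield X -> section phi V -> section phi (D X V)),
      (forall (f : N -> R) X X' V, smooth_fun f ->
         vfield X -> vfield X' -> section phi V ->
         D (fun p => f p *: X p + X' p) V =
           (fun p => f p *: D X V p + D X' V p)),
      (forall X V V', vfield X -> section phi V -> section phi V' ->
         D X (fun p => V p + V' p) = (fun p => D X V p + D X V' p)) &
      (forall (f : N -> R) X V, smooth_fun f -> vfield X -> section phi V ->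
         D X (fun p => f p *: V p) =
           (fun p => (X p f : R) *: V p + f p *: D X V p))].

(* Only the values at vector fields matter. *)
Definition operation (R : realType) n (M : manifold R n) :=
  (M -> operator M) -> (M -> operator M) -> (M -> operator M).

Definition connection (R : realType) n (M : manifold R n)
    (D : operation M) : Prop := connection_along (fun p : M => p) D.

Definition symplectic_connection (R : realType) n (M : manifold R n)
    (Om : form2 M) (D : operation M) : Prop :=
  [/\ connection D,
      (forall X Y, vfield X -> vfield Y ->
         (fun p => D X Y p - D Y X p) = bracket X Y) &
      (forall X Y Z p, vfield X -> vfield Y -> vfield Z ->
         X p (fun q => Om q (Y q) (Z q)) =
           Om p (D X Y p) (Z p) + Om p (Y p) (D X Z p))].

Definition curvature (R : realType) n (M : manifold R n) (D : operation M)
    (X Y Z : M -> operator M) : M -> operator M := fun p =>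
  D X (D Y Z) p - D Y (D X Z) p - D (bracket X Y) Z p.

Definition curvature_at (R : realType) n (M : manifold R n) (D : operation M)
    (p : M) (x y z : operator M) : operator M :=
  curvature D (extension p x) (extension p y) (extension p z) p.

Definition span2 (R : realType) n (M : manifold R n) (x y : operator M) :
    set (operator M) :=
  [set v | exists a b : R, v = a *: x + b *: y].

Definition plane_basis (R : realType) n (M : manifold R n)
    (L : set (operator M)) (x y : operator M) : Prop :=
  (forall a b : R, a *: x + b *: y = 0 -> a = 0 /\ b = 0) /\ L = span2 x y.

Definition symplectic_plane (R : realType) n (M : manifold R n) (Om : form2 M)
    (p : M) (L : set (operator M)) : Prop :=
  [/\ L `<=` tangent p, (exists x y, plane_basis L x y) &
      nondegenerate_on L (Om p)].

(* The quotient does not depend on the basis of L that is picked. *)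
Definition sympl_curvature (R : realType) n (M : manifold R n) (Om : form2 M)
    (D : operation M) (p : M) (L : set (operator M)) (z : operator M) : R :=
  let b := xget (0, 0) [set b | plane_basis L b.1 b.2] in
  Om p (curvature_at D p b.1 b.2 z) z / Om p b.1 b.2.

(* D' is the connection on phi^*TM induced by D:
   D'_X (W \o phi) = D_(T phi X) W. *)
Definition pullback_connection (R : realType) m n (N : manifold R n)
    (M : manifold R m) (phi : N -> M) (D : operation M)
    (D' : (N -> operator N) -> (N -> operator M) -> (N -> operator M)) : Prop :=
  connection_along phi D' /\
  forall X W p, vfield X -> vfield W ->
    D' X (fun q => W (phi q)) p =
      D (extension (phi p) (tangent_map phi (X p))) W (phi p).

(* The second clause says that T phi (Dbar_X Y) is the projection of
   D'_X (T phi Y) on phi_* (TN) along its Om-orthogonal. *)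
Definition induced_connection (R : realType) m n (N : manifold R n)
    (M : manifold R m) (phi : N -> M) (Om : form2 M)
    (D' : (N -> operator N) -> (N -> operator M) -> (N -> operator M))
    (Dbar : operation N) : Prop :=
  connection Dbar /\
  forall X Y p u, vfield X -> vfield Y -> tangent p u ->
    Om (phi p)
       (D' X (fun q => tangent_map phi (Y q)) p - tangent_map phi (Dbar X Y p))
       (tangent_map phi u) = 0.

Definition second_fundamental_form (R : realType) m n (N : manifold R n)
    (M : manifold R m) (phi : N -> M)
    (D' : (N -> operator N) -> (N -> operator M) -> (N -> operator M))
    (Dbar : operation N) (p : N) (x y : operator N) : operator M :=
  let X := extension p x in let Y := extension p y in
  D' X (fun q => tangent_map phi (Y q)) p - tangent_map phi (Dbar X Y p).

(* Main.v *)
Require Import Defs.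
From mathcomp Require Import all_boot all_order all_algebra.
From mathcomp Require Import all_classical all_reals all_analysis.
From mathcomp Require Import ring.

Set Implicit Arguments.
Unset Strict Implicit.
Unset Printing Implicit Defensive.

Import Order.TTheory GRing.Theory Num.Theory.
Import numFieldNormedType.Exports.

Local Open Scope classical_set_scope.
Local Open Scope ring_scope.

(** The statement is the Gauss equation, contracted with a vector of the plane.
    For vector fields [X], [Y], [Z] on [N] write [D'] for the connection on
    [phi^*TM] and split [D'_Y (T phi Z) = T phi (Dbar_Y Z) + Pi(Y, Z)].
    Applying [D'_X] and pairing with [T phi Z], to which [Pi] is orthogonal,
    leaves [Om (T phi (Dbar_X Dbar_Y Z)) (T phi Z)] and the term
    [Om (D'_X (Pi(Y, Z))) (T phi Z)].  Differentiating
    [Om (Pi(Y, Z)) (T phi Z) = 0] along [X] identifies the latter with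
    [Om (Pi(X, Z)) (Pi(Y, Z))].  Exchanging [X] and [Y] changes its sign, so
    the curvature of [D'] differs from that of [Dbar] by twice this term
    ([gauss_equation]).

    Three facts connect this computation to the statement.  The curvature of
    [D'] is the pullback of the curvature of [D]
    ([pullback_curvature_expand]); for the identity map the same formula says
    that the value of a curvature at tangent vectors does not depend on the
    fields which extend them, and that a change of basis of a plane multiplies
    it by a determinant ([curvature_at_det]), so that any basis computes the
    symplectic curvature ([sympl_curvature_basis]).  Second, [D'] preserves
    [Om] ([pullback_connection_symplectic]).  Both are local computations in a
    frame, and both rest on [tensorial_expand]: a rule on sections that is
    linear over the smooth functions can be evaluated on the restrictions to
    [N] of the fields of a frame of [M].  Third, every tangent vector extends to
    a vector field ([extensionP]), and the bracket of two fields is a field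
    ([bracket_vfield]).

    As the connections are operators on global fields, all local arguments are
    made with cut-off functions.  They come from [exp (- 1 / t)], whose
    smoothness is proved by observing that its products with polynomials in
    [1 / t] are stable under differentiation ([is_derive_flat]).  The remaining
    analytic inputs are the chain rule ([Ck_on_comp]) and the symmetry of
    second derivatives ([derive_sym]), which is what makes a bracket a
    vector field. *)

(** * Calculus of functions of class C^k *)

Section SmoothCalculus.
Variables (R : realType) (V : normedModType R).

Lemma near_eq_differentiable (W : normedModType R) (f g : V -> W) (x : V) :
  (\near x, f x = g x) -> differentiable f x -> differentiable g x.
Proof.
move=> fg df.
have fgx := nbhs_singleton fg.
have [cdf /eqaddoP ef] := (diff_locallyP x f).1 df.
have e : g \o shift x = cst (g x) + 'd f x +o_ (0 : V) id.
  apply/eqaddoP => e e0; have := ef e e0.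
  have fg0 : \forall y \near (0 : V), f (y + x) = g (y + x).
    have := fg; rewrite (near_shift 0 x) subr0.
    exact.
  apply: filterS2 fg0 => y fgy; rewrite !fctE /=.
  by rewrite fgx fgy.
have dg := diff_unique cdf e.
by apply/diff_locallyP; rewrite dg.
Unshelve. all: by end_near. Qed.

Lemma Ck_on_sub (W : normedModType R) k (U U' : set V) (f : V -> W) :
  U' `<=` U -> Ck_on k U f -> Ck_on k U' f.
Proof.
move=> UU'; elim: k f => [|k IH] f /=; first by move=> h x /UU' /h.
by move=> [df h]; split=> [x /UU' /df //|v]; exact: IH.
Qed.

Lemma Ck_onW (W : normedModType R) k (U : set V) (f : V -> W) :
  Ck_on k.+1 U f -> Ck_on k U f.
Proof.
elim: k f => [|k IH] f /= [df h].
  by move=> x /df /differentiable_continuous.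
by split=> // v; apply: IH; exact: h.
Qed.

Lemma Ck_on_eq (W : normedModType R) k (U : set V) (f g : V -> W) :
  open U -> (forall x, U x -> f x = g x) -> Ck_on k U f -> Ck_on k U g.
Proof.
move=> oU; elim: k f g => [|k IH] f g fg /=.
  move=> cf x Ux; have := cf x Ux; rewrite /prop_for /continuous_at -(fg _ Ux).
  apply: cvg_trans; apply: near_eq_cvg.
  by near=> y; apply/fg; near: y; exact: open_nbhs_nbhs.
move=> [df h]; split=> [x Ux|v].
  apply: near_eq_differentiable (df x Ux).
  by near=> y; apply/fg; near: y; exact: open_nbhs_nbhs.
apply: IH (h v) => x Ux; apply: near_eq_derive.
by near=> y; apply/fg; near: y; exact: open_nbhs_nbhs.
Unshelve. all: by end_near. Qed.

Lemma Ck_on_local (W : normedModType R) k (U : set V) (f : V -> W) :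
  (forall x, U x -> exists2 O : set V, O x & Ck_on k O f) -> Ck_on k U f.
Proof.
elim: k f => [|k IH] f h /=; first by move=> x /h [A Ox]; apply.
split=> [x /h [A Ox [+ _]]|v]; first by apply.
by apply: IH => x /h [A Ox [_ /(_ v) ?]]; exists A.
Qed.

Lemma Ck_on_cst (W : normedModType R) k (U : set V) (a : W) :
  Ck_on k U (fun=> a).
Proof.
elim: k a => [|k IH] a /=; first by move=> x _; exact: cvg_cst.
split=> [x _|v]; first exact: differentiable_cst.
rewrite (_ : 'D_v _ = fun=> 0); first exact: IH.
by apply/funext => x; exact: derive_cst.
Qed.

Lemma Ck_onD (W : normedModType R) k (U : set V) (f g : V -> W) : open U ->
  Ck_on k U f -> Ck_on k U g -> Ck_on k U (fun x => f x + g x).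
Proof.
move=> oU; elim: k f g => [|k IH] f g /=.
  by move=> cf cg x Ux; apply: cvgD; [exact: cf|exact: cg].
move=> [df hf] [dg hg]; split=> [x Ux|v].
  by apply: differentiableD; [exact: df|exact: dg].
apply: (Ck_on_eq oU) (IH _ _ (hf v) (hg v)) => x Ux.
by rewrite deriveD//; apply: diff_derivable; [exact: df|exact: dg].
Qed.

Lemma Ck_on_sum (W : normedModType R) k (U : set V) (I : Type) (s : seq I)
    (f : I -> V -> W) : open U ->
  (forall i, Ck_on k U (f i)) -> Ck_on k U (fun x => \sum_(i <- s) f i x).
Proof.
move=> oU h; elim: s => [|i s IH].
  by rewrite (_ : (fun _ => _) = fun=> 0); [exact: Ck_on_cst|
    apply/funext => x; rewrite big_nil].
rewrite (_ : (fun _ => _) = fun x => f i x + \sum_(i <- s) f i x).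
  exact: Ck_onD.
by apply/funext => x; rewrite big_cons.
Qed.

Lemma Ck_onM k (U : set V) (f g : V -> R^o) : open U ->
  Ck_on k U f -> Ck_on k U g -> Ck_on k U (fun x => f x * g x : R^o).
Proof.
move=> oU; elim: k f g => [|k IH] f g.
  by move=> cf cg x Ux; exact: (@continuousM R V f g x (cf x Ux) (cg x Ux)).
move=> Cf Cg; have [df hf] := Cf; have [dg hg] := Cg.
split=> [x Ux|v].
  by apply: differentiableM; [exact: df|exact: dg].
apply: (@Ck_on_eq _ _ _ (fun x => f x * 'D_v g x + g x * 'D_v f x : R^o)) => //.
  move=> x Ux; apply/esym/(@deriveM R V f g x v); apply: diff_derivable.
    exact: df.
  exact: dg.
apply: Ck_onD => //; apply: IH; [exact: Ck_onW Cf|exact: hg|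
  exact: Ck_onW Cg|exact: hf].
Qed.

Lemma Ck_onN k (U : set V) (f : V -> R^o) : open U ->
  Ck_on k U f -> Ck_on k U (fun x => - f x).
Proof.
move=> oU Cf; apply: Ck_on_eq (Ck_onM oU (@Ck_on_cst R^o k U (-1)) Cf) => //.
by move=> x _; rewrite mulN1r.
Qed.

Lemma Ck_onV k (U : set V) (f : V -> R^o) : open U ->
  (forall x, U x -> f x != 0) -> Ck_on k U f ->
  Ck_on k U (fun x => (f x)^-1 : R^o).
Proof.
move=> oU f0; elim: k => [|k IH] Cf.
  by move=> x Ux; exact: (@continuousV R V f x (f0 x Ux) (Cf x Ux)).
have CV := IH (Ck_onW Cf); have [df hf] := Cf.
split=> [x Ux|v].
  by apply: differentiableV; [exact: df|exact: f0].
apply: (@Ck_on_eq _ _ _ (fun x => - ((f x)^-1 * (f x)^-1 * 'D_v f x) : R^o)) => //.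
  move=> x Ux; rewrite (deriveV (f0 x Ux)); last exact: diff_derivable (df x Ux).
  by rewrite -mulNr -invfM.
by apply: Ck_onN oU (Ck_onM oU (Ck_onM oU CV CV) (hf v)).
Qed.

Lemma Ck_on_coord k (U : set V) m (f : V -> 'rV[R]_m) (i : 'I_m) : open U ->
  Ck_on k U f -> Ck_on k U (fun x => f x 0 i : R^o).
Proof.
move=> oU; elim: k f => [|k IH] f.
  move=> cf x Ux; exact: (continuous_comp (cf x Ux) (@coord_continuous _ _ _ _ _ _)).
move=> [df h]; split=> [x Ux|v].
  exact: (differentiable_comp (df x Ux) (@differentiable_coord _ _ _ _ _ _)).
apply: (Ck_on_eq oU) (IH _ (h v)) => x Ux.
by rewrite derive_mx ?mxE//; exact: diff_derivable (df x Ux).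
Qed.

Lemma derive_comp (W W' : normedModType R) (f : V -> W) (g : W -> W')
    (x v : V) :
  differentiable f x -> differentiable g (f x) ->
  'D_v (g \o f) x = 'D_('D_v f x) g (f x).
Proof.
move=> df dg; rewrite deriveE; last exact: differentiable_comp.
by rewrite (diff_comp df dg) /= -(deriveE v df) -deriveE.
Qed.

Lemma derive_linear (W : normedModType R) (f : V -> W) (x v w : V) (a : R) :
  differentiable f x -> 'D_(a *: v + w) f x = a *: 'D_v f x + 'D_w f x.
Proof. by move=> df; rewrite !deriveE// linearP. Qed.

Lemma derive_sum_dir (V' W : normedModType R) (f : V' -> W) (x : V')
    (I : Type) (s : seq I) (a : I -> R) (v : I -> V') :
  differentiable f x ->
  'D_(\sum_(i <- s) a i *: v i) f x = \sum_(i <- s) a i *: 'D_(v i) f x.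
Proof.
move=> df; rewrite deriveE// linear_sum; apply: eq_bigr => i _.
by rewrite linearZ deriveE.
Qed.

(** Writes the derivative of a composite with the partial derivatives of the
    outer function only, which makes an induction on the order of
    differentiability possible. *)
Lemma derive_comp_rV m (f : V -> 'rV[R]_m) (g : 'rV[R]_m -> R^o) (x v : V) :
  differentiable f x -> differentiable g (f x) ->
  'D_v (g \o f) x = \sum_i 'D_v f x 0 i * 'D_(delta_mx 0 i) g (f x) :> R^o.
Proof.
move=> df dg; rewrite derive_comp//.
rewrite -(derive_sum_dir _ (fun i => 'D_v f x 0 i) (delta_mx 0) dg).
by rewrite -row_sum_delta.
Qed.

Lemma Ck_on_comp k (U : set V) m (O : set 'rV[R]_m) (f : V -> 'rV[R]_m)
    (g : 'rV[R]_m -> R^o) : open U -> (forall x, U x -> O (f x)) ->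
  Ck_on k U f -> Ck_on k O g -> Ck_on k U (g \o f).
Proof.
move=> oU UO; elim: k g => [|k IH] g Cf Cg.
  by move=> x Ux; apply: continuous_comp; [exact: Cf|exact: Cg (UO x Ux)].
have [df hf] := Cf; have [dg hg] := Cg.
split=> [x Ux|v].
  by apply: differentiable_comp; [exact: df|exact: dg (UO x Ux)].
apply: (Ck_on_eq oU) => [x Ux|]; first by
  rewrite derive_comp_rV; [reflexivity|exact: df|exact: dg (UO x Ux)].
apply: Ck_on_sum => // i; apply: Ck_onM => //.
  exact: Ck_on_coord oU (hf v).
exact: (IH _ (Ck_onW Cf) (hg _)).
Qed.

End SmoothCalculus.

(** * Symmetry of second derivatives *)

Section SecondDerivatives.
Variables (R : realType) (V : normedModType R).

Lemma is_derive_line (f : V -> R^o) (a u : V) (s : R) :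
  differentiable f (s *: u + a) ->
  is_derive s 1 (fun t : R => f (t *: u + a) : R) ('D_u f (s *: u + a)).
Proof.
move=> df.
have dl : is_diff s (fun t : R => t *: u + a) (fun t => t *: u).
  apply: is_diff_eq; apply/funext => t /=; rewrite /= addr0.
  by [].
have dfl : differentiable (f \o (fun t : R => t *: u + a)) s.
  by apply: differentiable_comp.
apply: DeriveDef; first exact: diff_derivable dfl.
rewrite [LHS](deriveE _ dfl).
rewrite (@diff_comp _ _ _ _ (fun t : R => t *: u + a) f s) //=.
by rewrite diff_val scale1r deriveE.
Qed.

(** The mixed second difference of [f] at [x] is a value of [D_v D_u f] near
    [x], by two applications of the mean value theorem; since the second
    difference is symmetric in [u] and [v], this is what forces the mixed
    derivatives to agree. *)
Lemma second_difference (f : V -> R^o) (U : set V) (x u v : V) (h : R) :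
  0 < h -> Ck_on 2 U f ->
  (forall y, `|y - x| <= h * (`|u| + `|v|) -> U y) ->
  exists2 y, `|y - x| <= h * (`|u| + `|v|) &
    f (h *: u + (h *: v + x)) - f (h *: u + x) - (f (h *: v + x) - f x)
      = h * h * 'D_v ('D_u f) y.
Proof.
move=> h0 [df hf] Uh; have [ddf _] := hf u.
have near_x s t : 0 <= s <= h -> 0 <= t <= h ->
    `|s *: u + (t *: v + x) - x| <= h * (`|u| + `|v|).
  move=> /andP[s0 sh] /andP[t0 th]; rewrite addrA addrK mulrDr.
  rewrite (le_trans (ler_normD _ _))// !normrZ !ger0_norm//.
  by rewrite lerD// ler_wpM2r.
have hh : 0 <= h <= h by rewrite lexx ltW.
have h00 : 0 <= (0 : R) <= h by rewrite lexx ltW.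
have dfst s t : 0 <= s <= h -> 0 <= t <= h ->
    differentiable f (s *: u + (t *: v + x)).
  by move=> hs ht; apply/df/Uh/near_x.
have eq0 s : s *: u + x = s *: u + (0 *: v + x) by rewrite scale0r add0r.
pose phi s : R := f (s *: u + (h *: v + x)) - f (s *: u + x).
pose dphi s : R := 'D_u f (s *: u + (h *: v + x)) - 'D_u f (s *: u + x).
have dphiE s : 0 <= s <= h -> is_derive s 1 phi (dphi s).
  move=> hs; apply: is_deriveB; apply: is_derive_line; first exact: dfst.
  by rewrite eq0; exact: dfst.
have [s /[!in_itv]/= /andP[s0 sh] es] : exists2 s, s \in `]0, h[%R &
    phi h - phi 0 = dphi s * (h - 0).
  apply: (MVT h0) => [s|]; first by
    rewrite in_itv /= => /andP[s0 sh]; apply: dphiE; rewrite !ltW.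
  apply: derivable_within_continuous => s; rewrite in_itv /= => hs.
  by have [] := dphiE s hs.
have hs : 0 <= s <= h by rewrite !ltW.
pose psi t : R := 'D_u f (t *: v + (s *: u + x)).
have dpsiE t : 0 <= t <= h ->
    is_derive t 1 psi ('D_v ('D_u f) (t *: v + (s *: u + x))).
  by move=> ht; apply: is_derive_line; apply/ddf/Uh; rewrite addrCA near_x.
have [t /[!in_itv]/= /andP[t0 th] et] : exists2 t, t \in `]0, h[%R &
    psi h - psi 0 = 'D_v ('D_u f) (t *: v + (s *: u + x)) * (h - 0).
  apply: (MVT h0) => [t|]; first by
    rewrite in_itv /= => /andP[t0 th]; apply: dpsiE; rewrite !ltW.
  apply: derivable_within_continuous => t; rewrite in_itv /= => ht.
  by have [] := dpsiE t ht.
have ht : 0 <= t <= h by rewrite !ltW.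
exists (t *: v + (s *: u + x)); first by rewrite addrCA near_x.
move: es et; rewrite /phi /dphi /psi !scale0r !add0r !subr0 => ->.
rewrite addrCA => ->.
by rewrite mulrC mulrA mulrAC -mulrA mulrC -mulrA mulrC.
Qed.

Lemma continuous_eq_of_close (A B : V -> R^o) (x : V) :
  {for x, continuous A} -> {for x, continuous B} ->
  (forall r, 0 < r -> exists y z,
     [/\ `|y - x| < r, `|z - x| < r & A y = B z]) -> A x = B x.
Proof.
move=> cA cB h; apply/eqP/negPn/negP; rewrite -subr_eq0 -normr_gt0 => neq.
pose e := `|A x - B x| / 2.
have e0 : 0 < e by rewrite divr_gt0.
have nA := (cvgrPdist_lt _ _).1 cA e e0.
have nB := (cvgrPdist_lt _ _).1 cB e e0.
have /nbhs_ballP[r1 /= r10 h1] : nbhs x (fun t => `|A x - A t| < e) by apply: nA.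
have /nbhs_ballP[r2 /= r20 h2] : nbhs x (fun t => `|B x - B t| < e) by apply: nB.
have [|y [z [yr zr yz]]] := h (Num.min r1 r2); first by rewrite lt_min r10.
have yb : ball x r1 y.
  by rewrite -ball_normE /= distrC (lt_le_trans yr)// ge_min lexx.
have zb : ball x r2 z.
  by rewrite -ball_normE /= distrC (lt_le_trans zr)// ge_min lexx orbT.
have : `|A x - B x| < e + e.
  rewrite (_ : A x - B x = (A x - A y) - (B x - B z)); last by rewrite yz; ring.
  by rewrite (le_lt_trans (ler_normB _ _))// ltrD//; [exact: h1|exact: h2].
by rewrite -splitr ltxx.
Qed.

(** Arbitrarily close to [x], both mixed derivatives take the value of the same
    second difference divided by [h * h]. *)
Lemma derive_sym (f : V -> R^o) (U : set V) (x u v : V) :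
  open U -> U x -> Ck_on 2 U f -> 'D_u ('D_v f) x = 'D_v ('D_u f) x.
Proof.
move=> oU Ux Cf; have [_ hf] := Cf.
apply: (@continuous_eq_of_close ('D_u ('D_v f)) ('D_v ('D_u f)) x) => [| |r r0].
- by have [_ /(_ u)] := hf v; apply.
- by have [_ /(_ v)] := hf u; apply.
have /nbhs_ballP[s /= s0 hs] := open_nbhs_nbhs (conj oU Ux).
pose c := `|u| + `|v| + 1.
have c0 : 0 < c by rewrite ltr_wpDl// addr_ge0.
pose h := Num.min r s / c.
have rs0 : 0 < Num.min r s by rewrite lt_min r0.
have h0 : 0 < h by rewrite divr_gt0.
have close y : `|y - x| <= h * (`|u| + `|v|) -> `|y - x| < Num.min r s.
  move=> /le_lt_trans; apply; rewrite /h -mulrA gtr_pMr// mulrC.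
  by rewrite ltr_pdivrMr// mul1r ltrDl.
have hU y : `|y - x| <= h * (`|u| + `|v|) -> U y.
  move=> /close yx; apply: hs; rewrite -ball_normE /= distrC (lt_le_trans yx)//.
  by rewrite ge_min lexx orbT.
have hU' y : `|y - x| <= h * (`|v| + `|u|) -> U y.
  by rewrite (addrC `|v|); exact: hU.
have [y yx ey] := second_difference h0 Cf hU'.
have [z zx ez] := second_difference h0 Cf hU.
have lt_r w : `|w - x| <= h * (`|u| + `|v|) -> `|w - x| < r.
  by move=> /close /lt_le_trans; apply; rewrite ge_min lexx.
exists y, z; split; [by apply: lt_r; rewrite (addrC `|u|)|exact: lt_r|].
apply: (@mulfI _ (h * h)); first by rewrite mulf_neq0// gt_eqF.
by rewrite -ey -ez addrCA; ring.
Qed.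

End SecondDerivatives.

(** * Bump functions on a vector space *)

Section Bump.
Variable R : realType.

(** The polynomial factor makes the family closed under differentiation, so
    that smoothness follows from differentiability alone. *)
Definition flat (P : {poly R}) (t : R) : R :=
  if 0 < t then P.[t^-1] * expR (- t^-1) else 0.

(** [flat (dflat P)] is the derivative of [flat P]. *)
Definition dflat (P : {poly R}) : {poly R} := 'X^2 * (P - P^`()).

Lemma horner_le_expR (P : {poly R}) :
  exists2 C, 0 <= C & forall x, 0 <= x -> `|P.[x]| <= C * expR x.
Proof.
exists (\sum_(i < size P) `|P`_i| * i`!%:R).
  by apply: sumr_ge0 => i _; rewrite mulr_ge0.
move=> x x0; rewrite horner_coef mulr_suml (le_trans (ler_norm_sum _ _ _))//.
apply: ler_sum => i _; rewrite normrM normrX (ger0_norm x0) -mulrA.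
apply: ler_wpM2l => //; case: (i : nat) => [|k].
  by rewrite expr0 fact0 mul1r -expR0 ler_expR.
rewrite -ler_pdivrMl ?ltr0n ?fact_gt0// mulrC.
by apply: le_trans (expR_ge1Dxn k x0); rewrite lerDr.
Qed.

(** A bound of order 2 in [t], since it has to give the derivative 0 at 0. *)
Lemma flat_le (P : {poly R}) : exists2 C, 0 <= C &
  forall t : R, `|flat P t| <= C * (t * t).
Proof.
have [C C0 hC] := horner_le_expR ('X^2 * P); exists C => // t.
rewrite /flat; case: ifPn => t0; last by rewrite normr0 mulr_ge0// -expr2 sqr_ge0.
have ti0 : 0 <= t^-1 by rewrite invr_ge0 ltW.
have := hC _ ti0; rewrite hornerM hornerXn normrM normrX (ger0_norm ti0) => h.
rewrite normrM (gtr0_norm (expR_gt0 _)) expRN.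
rewrite ler_pdivrMr ?expR_gt0// mulrAC -[leLHS]mul1r.
have -> : C * expR t^-1 * (t * t) = (C * expR t^-1) * t ^+ 2 by rewrite expr2.
rewrite -ler_pdivrMr ?exprn_gt0// (le_trans _ h)//.
by rewrite mul1r mulrC -exprVn.
Qed.

Lemma is_derive_flat (P : {poly R}) (t : R) :
  is_derive t 1 (flat P) (flat (dflat P) t).
Proof.
have [t0|t0|->] := ltgtP t 0.
- have -> : flat (dflat P) t = 0 by rewrite /flat ltNge (ltW t0).
  apply: (near_eq_is_derive _ (is_derive_cst (0 : R) t 1)).
  by near=> s; rewrite /flat ltNge ltW//; near: s; exact: lt_nbhsl.
- have tn0 : t != 0 by rewrite gt_eqF.
  have dV : is_derive t 1 (fun s : R => s^-1) (- t ^- 2).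
    apply: is_derive_eq (is_deriveV tn0 (is_derive_id t 1)) _.
    exact: mulr1.
  have dP : is_derive t 1 (horner P \o GRing.inv) (P^`().[t^-1] * - t ^- 2).
    exact: is_derive1_comp.
  have dE : is_derive t 1 (expR \o (fun s : R => - s^-1))
      (expR (- t^-1) * t ^- 2).
    have dN : is_derive t 1 (fun s : R => - s^-1) (t ^- 2).
      exact: is_derive_eq (is_deriveN dV) (opprK _).
    exact: is_derive1_comp.
  apply: (near_eq_is_derive _ (is_derive_eq (is_deriveM dP dE) _)).
    by near=> s; rewrite /flat ifT//; near: s; exact: lt_nbhsr.
  rewrite /flat t0 /dflat hornerM hornerXn hornerD hornerN /= /GRing.scale /=.
  by rewrite exprVn; ring.
have -> : flat (dflat P) 0 = 0 by rewrite /flat ltxx.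
have [C C0 hC] := flat_le P.
have cv : h^-1 *: (flat P (h *: (1 : R) + 0) - flat P 0) @[h --> 0^'] --> (0 : R).
  apply/cvgrPdist_le => /= e e0.
  have Ce0 : 0 < e / (C + 1) by rewrite divr_gt0// ltr_wpDl.
  near=> h.
  have h0 : h != 0 by near: h; exact: nbhs_dnbhs_neq.
  rewrite sub0r normrN addr0 [_ *: 1]mulr1 {2}/flat ltxx subr0 normrZ normfV.
  rewrite ler_pdivrMl ?normr_gt0// (le_trans (hC h))//.
  rewrite (le_trans (ler_norm _))// !normrM mulrCA ler_wpM2l//.
  rewrite (ger0_norm C0) (@le_trans _ _ ((C + 1) * (e / (C + 1))))//.
    apply: ler_pM => //; first by rewrite lerDl.
    by near: h; exact: dnbhs0_le.
  by rewrite mulrC divfK// gt_eqF// ltr_wpDl.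
by apply: DeriveDef; [apply/cvg_ex; exists 0|apply/cvg_lim].
Unshelve. all: by end_near. Qed.

Lemma Ck_on_flat (V : normedModType R) k (U : set V) (P : {poly R})
    (f : V -> R^o) :
  open U -> Ck_on k U f -> Ck_on k U (fun x => flat P (f x) : R^o).
Proof.
move=> oU.
have dflatP Q t : differentiable (flat Q : R -> R^o) t.
  by apply/derivable1_diffP; have [] := is_derive_flat Q t.
elim: k P => [|k IH] P Cf.
  move=> x Ux; apply: (continuous_comp (Cf x Ux)).
  exact/differentiable_continuous/dflatP.
have [df hf] := Cf; split=> [x Ux|v].
  by apply: differentiable_comp (dflatP _ _); exact: df.
apply: (@Ck_on_eq _ _ _ _ _ (fun x => 'D_v f x * flat (dflat P) (f x) : R^o) _ oU).
  move=> x Ux.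
  have dc : differentiable ((flat P : R^o -> R^o) \o f) x.
    by apply: differentiable_comp (dflatP _ _); exact: df.
  rewrite [RHS](deriveE _ dc) (diff_comp (df x Ux) (dflatP _ _)) /=.
  rewrite -(deriveE _ (df x Ux)) -[X in 'd _ _ X]mulr1 [RHS]linearZ /=.
  by rewrite -deriveE//; congr (_ * _); have [_ ->] := is_derive_flat P (f x).
exact: Ck_onM oU (hf v) (IH _ (Ck_onW Cf)).
Qed.

Definition smooth_step (t : R) : R := flat 1 t / (flat 1 t + flat 1 (1 - t)).

Lemma flat1_gt0 t : 0 < t -> 0 < flat 1 t.
Proof. by move=> t0; rewrite /flat t0 hornerC mul1r expR_gt0. Qed.

Lemma flat1_ge0 t : 0 <= flat 1 t.
Proof. by rewrite /flat; case: ifP => // _; rewrite hornerC mul1r expR_ge0. Qed.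

Lemma flat_eq0 P t : t <= 0 -> flat P t = 0.
Proof. by rewrite /flat leNgt => /negbTE ->. Qed.

Lemma smooth_step_den t : flat 1 t + flat 1 (1 - t) != 0.
Proof.
rewrite gt_eqF//; have [t0|t0] := ltP 0 t.
  by rewrite ltr_pwDl ?flat1_gt0 ?flat1_ge0.
by rewrite ltr_wpDl ?flat1_ge0// flat1_gt0// subr_gt0 (le_lt_trans t0).
Qed.

Lemma smooth_step0 t : t <= 0 -> smooth_step t = 0.
Proof. by move=> t0; rewrite /smooth_step flat_eq0// mul0r. Qed.

Lemma smooth_step1 t : 1 <= t -> smooth_step t = 1.
Proof.
move=> t1; have := smooth_step_den t; rewrite /smooth_step.
by rewrite (@flat_eq0 _ (1 - t)) ?subr_le0// addr0 => /divff.
Qed.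

Lemma Ck_on_smooth_step (V : normedModType R) k (U : set V) (f : V -> R^o) :
  open U -> Ck_on k U f -> Ck_on k U (fun x => smooth_step (f x) : R^o).
Proof.
move=> oU Cf; apply: (Ck_onM oU); first exact: Ck_on_flat.
apply: (Ck_onV oU) => [x _|]; first exact: smooth_step_den.
apply: (Ck_onD oU); first exact: Ck_on_flat.
apply: (Ck_on_flat 1 oU); apply: (Ck_onD oU); first exact: Ck_on_cst.
exact: Ck_onN.
Qed.

Lemma Ck_on_id_coord m k (i : 'I_m) :
  Ck_on k setT (fun x : 'rV[R]_m => x 0 i : R^o).
Proof.
case: k => [|k]; first by move=> x _; exact: coord_continuous.
split=> [x _|v]; first exact: differentiable_coord.
rewrite (_ : 'D_v _ = fun=> v 0 i); first exact: Ck_on_cst.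
apply/funext => x; pose l : 'rV[R]_m -> 'rV[R]_m := id.
have dl : derivable l x v by exact: derivable_id.
have := derive_mx dl.
by rewrite [LHS]derive_id => /rowP/(_ i); rewrite mxE.
Qed.

(** The cut-off is a function of the squared Euclidean distance to [a], which
    is a polynomial; it is at least the square of the max norm. *)
Lemma smooth_bump m (a : 'rV[R]_m) (r : R) : 0 < r ->
  exists psi : 'rV[R]_m -> R^o, [/\ smooth_on setT psi,
    (\forall x \near a, psi x = 1) & forall x, r <= `|x - a| -> psi x = 0].
Proof.
move=> r0; have r20 : 0 < r ^+ 2 by rewrite exprn_gt0.
pose sq (x : 'rV[R]_m) : R := \sum_i (x 0 i - a 0 i) * (x 0 i - a 0 i).
have Csq k : Ck_on k setT (sq : _ -> R^o).
  apply: Ck_on_sum; first exact: openT.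
  move=> i; have Ci : Ck_on k setT (fun x : 'rV[R]_m => x 0 i - a 0 i : R^o).
    by apply: Ck_onD; [exact: openT|exact: Ck_on_id_coord|exact: Ck_on_cst].
  by apply: Ck_onM; [exact: openT| |].
exists (fun x => smooth_step (2 + - (2 / r ^+ 2 * sq x))); split.
- move=> k; apply: (Ck_on_smooth_step openT).
  apply: (Ck_onD openT); first exact: Ck_on_cst.
  apply: (Ck_onN openT); apply: (Ck_onM openT); last exact: Csq.
  exact: Ck_on_cst.
- have sqa : sq a = 0.
    by rewrite /sq big1// => i _; rewrite subrr mul0r.
  have := Csq 0%N a I; rewrite /prop_for /continuous_at sqa.
  move=> /cvgrPdist_lt/(_ (r ^+ 2 / 2)); rewrite divr_gt0// => /(_ isT).
  apply: filterS => x; rewrite sub0r normrN => /ltW/(le_trans (ler_norm _)) h.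
  apply: smooth_step1; rewrite lerBrDr addrC -lerBrDr.
  rewrite mulrC mulrA ler_pdivrMr// (_ : 2 - 1 = 1 :> R) ?mul1r; last by ring.
  by rewrite -ler_pdivlMr.
- move=> x xr; apply: smooth_step0; rewrite subr_le0.
  have xa : mx_norm (x - a) != 0.
    by rewrite gt_eqF// (lt_le_trans r0 xr).
  have [[j i] /= e] := mx_norm_neq0 xa; move: xr e; rewrite /Num.norm /= => xr e.
  move: xr; rewrite e ord1 !mxE => xr.
  rewrite mulrAC ler_pdivlMr// ler_pM2l// /sq (bigD1 i)//=.
  rewrite (@le_trans _ _ ((x 0 i - a 0 i) * (x 0 i - a 0 i)))//.
    rewrite -expr2 -(ger0_norm (sqr_ge0 (x 0 i - a 0 i))) normrX !expr2.
    by apply: ler_pM => //; exact: ltW.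
  by rewrite lerDl sumr_ge0// => l _; rewrite -expr2 sqr_ge0.
Qed.

End Bump.

(** * Smooth functions on a manifold *)

Lemma chart_imP (R : realType) n (T : topologicalType) (c : chart R n T) x :
  is_chart c -> chart_im c x ->
  chart_dom c (chart_inv c x) /\ chart_map c (chart_inv c x) = x.
Proof. by move=> [_ _ cK _ _] [p cp <-]; rewrite cK. Qed.

Lemma chart_image (R : realType) n (T : topologicalType) (c : chart R n T)
    (A : set T) : is_chart c ->
  chart_map c @` (chart_dom c `&` A) =
    chart_im c `&` [set x | A (chart_inv c x)].
Proof.
move=> hc; have [_ _ cK _ _] := hc; apply/seteqP; split=> x /=.
  by move=> [p [cp Ap] <-]; split; [exists p|rewrite cK].
move=> [cx Ax]; have [? ?] := chart_imP hc cx.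
by exists (chart_inv c x).
Qed.

Lemma open_chart_image (R : realType) n (T : topologicalType)
    (c : chart R n T) (A : set T) : is_chart c -> open A ->
  open (chart_map c @` (chart_dom c `&` A)).
Proof.
move=> hc oA; rewrite (chart_image _ hc); have [_ oi _ _ ci] := hc.
rewrite openE => x [cx Ax]; apply: filterI; first exact: open_nbhs_nbhs.
by apply: ci => //; exact: open_nbhs_nbhs.
Qed.

Lemma open_chart_preimage (R : realType) n (T : topologicalType)
    (c : chart R n T) (B : set 'rV[R]_n) : is_chart c -> open B ->
  open (chart_dom c `&` [set p | B (chart_map c p)]).
Proof.
move=> [od _ _ cc _] oB; rewrite openE => p [cp Bp].
apply: filterI; first exact: open_nbhs_nbhs.
by apply: cc => //; exact: open_nbhs_nbhs.
Qed.

Section SmoothFunctions.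
Variables (R : realType) (n : nat) (M : manifold R n).

Let hchart := @manifold_chart R n M.

(** One chart around each point is enough, because the transition maps are
    smooth. *)
Lemma smooth_fun_local (f : M -> R) :
  (forall p, exists2 c, atlas c /\ chart_dom c p &
     exists2 O : set 'rV[R]_n, open O /\ O (chart_map c p) &
       smooth_on O (f \o chart_inv c : 'rV[R]_n -> R^o)) ->
  smooth_fun f.
Proof.
move=> h d ad k; apply: Ck_on_local => x dx.
have [dp px] := chart_imP (hchart ad) dx.
have [c [ac cp] [B [oB Bp] fB]] := h (chart_inv d x).
pose A := chart_dom c `&` [set q | B (chart_map c q)].
have oA : open A := open_chart_preimage (hchart ac) oB.
pose W := chart_map d @` (chart_dom d `&` A).
have oW : open W := open_chart_image (hchart ad) oA.
have [_ _ dK _ _] := hchart ad; have [_ _ cK _ _] := hchart ac.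
exists W; first by exists (chart_inv d x).
have CW : Ck_on k W (chart_map c \o chart_inv d).
  apply: Ck_on_sub (manifold_compat ad ac k) => y [q [dq [cq _]] <-].
  by exists q.
have WB y : W y -> B ((chart_map c \o chart_inv d) y).
  by move=> [q [dq [_ Bq]] <-] /=; rewrite dK.
apply: (Ck_on_eq oW) (Ck_on_comp oW WB CW (fB k)) => y [q [dq [cq _]] <-] /=.
by rewrite dK// cK.
Qed.

Lemma smooth_fun_near (f : M -> R) :
  (forall p : M, exists2 g, smooth_fun g & \forall q \near p, f q = g q) ->
  smooth_fun f.
Proof.
move=> h; apply: smooth_fun_local => p.
have [c ac cp] := manifold_cover p; have [_ _ cK _ _] := hchart ac.
have [g sg] := h p; rewrite /prop_near1 nbhsE => -[A [oA Ap] fgA].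
exists c => //; pose B := chart_map c @` (chart_dom c `&` A).
have oB : open B := open_chart_image (hchart ac) oA.
exists B; first by split=> //; exists p.
move=> k; apply: (Ck_on_eq oB) (Ck_on_sub _ (sg c ac k)).
  by move=> x [q [cq Aq] <-] /=; rewrite cK// fgA.
by move=> x [q [cq Aq] <-]; exists q.
Qed.

Lemma smooth_fun_cst (a : R) : smooth_fun (fun _ : M => a).
Proof. by move=> c ac k; exact: (@Ck_on_cst _ _ R^o). Qed.

Lemma smooth_funD (f g : M -> R) :
  smooth_fun f -> smooth_fun g -> smooth_fun (fun p => f p + g p).
Proof.
move=> sf sg c ac k; have [_ oi _ _ _] := hchart ac.
exact: Ck_onD oi (sf c ac k) (sg c ac k).
Qed.

Lemma smooth_funM (f g : M -> R) :
  smooth_fun f -> smooth_fun g -> smooth_fun (fun p => f p * g p).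
Proof.
move=> sf sg c ac k; have [_ oi _ _ _] := hchart ac.
exact: Ck_onM oi (sf c ac k) (sg c ac k).
Qed.

Lemma smooth_funB (f g : M -> R) :
  smooth_fun f -> smooth_fun g -> smooth_fun (fun p => f p - g p).
Proof.
move=> sf sg; have := smooth_funD sf (smooth_funM (smooth_fun_cst (-1)) sg).
by under eq_fun do rewrite mulN1r.
Qed.

Lemma smooth_fun_sum (I : Type) (s : seq I) (f : I -> M -> R) :
  (forall i, smooth_fun (f i)) -> smooth_fun (fun p => \sum_(i <- s) f i p).
Proof.
move=> sf c ac k; have [_ oi _ _ _] := hchart ac.
exact: (Ck_on_sum s oi (fun i => sf i c ac k)).
Qed.

Lemma smooth_map_id : smooth_map (fun p : M => p).
Proof.
split; first by move=> p; exact: cvg_id.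
by move=> c d ac ad; exact: manifold_compat.
Qed.

Definition chart_ext (c : chart R n M) (g : 'rV[R]_n -> R) : M -> R := fun q =>
  if `[< chart_dom c q >] then g (chart_map c q) else 0.

Lemma chart_extE c g q : chart_dom c q -> chart_ext c g q = g (chart_map c q).
Proof. by move=> cq; rewrite /chart_ext asboolT. Qed.

(** Off the closed set [K] the extension by 0 vanishes near each point, also
    near the boundary of the domain of the chart. *)
Lemma smooth_chart_ext (c : chart R n M) (K : set M) (g : 'rV[R]_n -> R^o) :
  atlas c -> closed K -> K `<=` chart_dom c ->
  (forall q, chart_dom c q -> ~ K q -> g (chart_map c q) = 0) ->
  smooth_on (chart_im c) g -> smooth_fun (chart_ext c g).
Proof.
move=> ac cK Kc g0 sg; apply: smooth_fun_local => p.
have [Kp|nKp] := pselect (K p).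
  have hc := hchart ac; have [_ oi _ _ _] := hc.
  exists c; first by split=> //; exact: Kc.
  exists (chart_im c); first by split=> //; exists p => //; exact: Kc.
  move=> k; apply: (Ck_on_eq oi) (sg k) => x cx /=.
  by have [cp e] := chart_imP hc cx; rewrite chart_extE// e.
have [d ad dp] := manifold_cover p; have hd := hchart ad.
exists d => //; have [_ _ dK _ _] := hd.
have oW := open_chart_image hd (closed_openC cK).
exists (chart_map d @` (chart_dom d `&` ~` K)); first by split=> //; exists p.
move=> k; apply: (Ck_on_eq oW) (@Ck_on_cst _ _ R^o _ _ 0).
move=> x [q [dq nKq] <-] /=; rewrite dK// /chart_ext.
by case: asboolP => // cq; rewrite g0.
Qed.

(** The set [K] is the image of a closed ball: it is compact, hence closed
    because the manifold is a Hausdorff space. *)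
Lemma cutoff_in_chart (c : chart R n M) (p : M) (A : set M) :
  atlas c -> chart_dom c p -> nbhs p A ->
  exists psi : 'rV[R]_n -> R^o, exists K : set M,
    [/\ smooth_on setT psi, (\forall x \near chart_map c p, psi x = 1),
        closed K, K `<=` chart_dom c `&` A &
        forall q, chart_dom c q -> ~ K q -> psi (chart_map c q) = 0].
Proof.
move=> ac cp /nbhs_interior; have hc := hchart ac; have [_ oi iK cc ci] := hc.
set B := A^° => nB; have Bp : B p := nbhs_singleton nB.
have oB : open B := open_interior _.
have oW := open_chart_image hc oB; set W := chart_map c @` _ in oW.
have Wp : W (chart_map c p) by exists p.
have /nbhs_ballP[r /= r0 rW] := open_nbhs_nbhs (conj oW Wp).
pose a := chart_map c p.
have r20 : 0 < r / 2 by rewrite divr_gt0.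
have [psi [spsi psi1 psi0]] := smooth_bump a r20.
pose D := closed_ball_ Num.norm a (r / 2).
have DW : D `<=` W.
  move=> x Dx; apply: rW; rewrite -ball_normE /= (le_lt_trans Dx)//.
  by rewrite ltr_pdivrMr// ltr_pMr// ltr1n.
have cD : compact D.
  apply: bounded_closed_compact; last first.
    by apply: closed_closed_ball_.
  exists (`|a| + r / 2); split; first exact: num_real.
  move=> y ry x Dx; apply: (le_trans _ (ltW ry)).
  rewrite -(subrK a x) addrC (le_trans (ler_normD _ _))// lerD2l distrC.
  exact: Dx.
exists psi, (chart_inv c @` D); split=> //.
- apply: compact_closed; first exact: manifold_hausdorff.
  apply: continuous_compact => //; apply: continuous_in_subspaceT => x.
  rewrite inE => /DW [q [cq _] <-]; apply: ci; by exists q.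
- move=> _ [x Dx <-]; have [q [cq Bq] <-] := DW _ Dx.
  by rewrite iK//; split=> //; exact: interior_subset.
- move=> q cq nKq; apply: psi0; rewrite leNgt; apply/negP => lt.
  apply: nKq; exists (chart_map c q); last by rewrite iK.
  by rewrite /D /closed_ball_ /= distrC ltW.
Qed.

Lemma near_chart (c : chart R n M) (p : M) (P : set 'rV[R]_n) :
  atlas c -> chart_dom c p -> (\forall x \near chart_map c p, P x) ->
  \forall q \near p, chart_dom c q /\ P (chart_map c q).
Proof.
move=> ac cp hP; have [od _ _ cc _] := hchart ac.
apply: filterI; first exact: open_nbhs_nbhs.
exact: cc.
Qed.

Lemma near_chart_inv (c : chart R n M) (p : M) (P : set M) :
  atlas c -> chart_dom c p -> (\forall q \near p, P q) ->
  \forall x \near chart_map c p, chart_im c x /\ P (chart_inv c x).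
Proof.
move=> ac cp hP; have [_ oi iK _ ci] := hchart ac.
have im : chart_im c (chart_map c p) by exists p.
apply: filterI; first exact: open_nbhs_nbhs.
by apply: ci => //=; rewrite iK.
Qed.

Lemma smooth_bump_fun (p : M) (A : set M) : nbhs p A ->
  exists psi : M -> R, [/\ smooth_fun psi, (\forall q \near p, psi q = 1) &
    forall q, ~ A q -> psi q = 0].
Proof.
move=> nA; have [c ac cp] := manifold_cover p.
have [psi [K [spsi psi1 cK KA psi0]]] := cutoff_in_chart ac cp nA.
exists (chart_ext c psi); split.
- apply: (smooth_chart_ext ac cK _ psi0); first by move=> q /KA [].
  by move=> k; apply: Ck_on_sub (spsi k).
- by apply: filterS (near_chart ac cp psi1) => q [cq]; rewrite chart_extE.
- move=> q nAq; rewrite /chart_ext; case: asboolP => // cq.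
  by rewrite psi0// => /KA [].
Qed.

End SmoothFunctions.

Lemma smooth_fun_comp (R : realType) m n (N : manifold R n) (M : manifold R m)
    (phi : N -> M) (f : M -> R) :
  smooth_map phi -> smooth_fun f -> smooth_fun (f \o phi).
Proof.
move=> [cphi sphi] sf; apply: smooth_fun_local => p.
have [c ac cp] := manifold_cover p.
have [d ad dp] := manifold_cover (phi p).
have hc := manifold_chart ac; have hd := manifold_chart ad.
have [_ _ cK _ _] := hc; have [od _ dK _ _] := hd.
have oA : open (phi @^-1` chart_dom d) by apply: open_comp => // q _; exact: cphi.
have oW := open_chart_image hc oA.
exists c => //; exists (chart_map c @` (chart_dom c `&` phi @^-1` chart_dom d)).
  by split=> //; exists p.
move=> k; have UO x : (chart_map c @` (chart_dom c `&` phi @^-1` chart_dom d)) x ->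
    chart_im d ((chart_map d \o phi \o chart_inv c) x).
  by move=> [q [cq dq] <-] /=; exists (phi q) => //; rewrite cK.
apply: (Ck_on_eq oW) (Ck_on_comp oW UO (sphi c d ac ad k) (sf d ad k)).
by move=> x [q [cq dq] <-] /=; rewrite cK// dK.
Qed.

(** * Tangent vectors and vector fields *)

Section TangentVectors.
Variables (R : realType) (n : nat) (M : manifold R n).

Lemma chart_vectorE (c : chart R n M) w (p : M) (f : M -> R) : smooth_fun f ->
  chart_vector c w p f =
    'D_w (f \o chart_inv c : 'rV[R]_n -> R^o) (chart_map c p).
Proof. by move=> sf; rewrite /chart_vector asboolT. Qed.

Lemma chart_vector0 (c : chart R n M) w (p : M) (f : M -> R) : ~ smooth_fun f ->
  chart_vector c w p f = 0.
Proof. by move=> sf; rewrite /chart_vector asboolF. Qed.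

Lemma tangent_non_smooth (p : M) v (f : M -> R) :
  tangent p v -> ~ smooth_fun f -> v f = 0.
Proof. by move=> [c [_ _ [w ->]]]; exact: chart_vector0. Qed.

Lemma differentiable_smooth_fun (c : chart R n M) (p : M) (f : M -> R) :
  atlas c -> chart_dom c p -> smooth_fun f ->
  differentiable (f \o chart_inv c : 'rV[R]_n -> R^o) (chart_map c p).
Proof. by move=> ac cp sf; have [+ _] := sf c ac 1%N; apply; exists p. Qed.

Lemma chart_vector_linear (c : chart R n M) (p : M) a w w' :
  atlas c -> chart_dom c p ->
  chart_vector c (a *: w + w') p =
    a *: chart_vector c w p + chart_vector c w' p.
Proof.
move=> ac cp; apply/funext => f.
change (chart_vector c (a *: w + w') p f =
  a *: chart_vector c w p f + chart_vector c w' p f).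
have [sf|sf] := pselect (smooth_fun f); last by
  rewrite !chart_vector0// scaler0 addr0.
by rewrite !chart_vectorE// derive_linear//; exact: differentiable_smooth_fun.
Qed.

End TangentVectors.

(** The chain rule.  For the identity map it is the rule for changing
    charts. *)
Lemma chart_vector_push (R : realType) m n (M : manifold R n)
    (N : manifold R m) (phi : M -> N) (c : chart R n M)
    (d : chart R m N) w (p : M) :
  smooth_map phi -> atlas c -> atlas d -> chart_dom c p ->
  chart_dom d (phi p) ->
  tangent_map phi (chart_vector c w p) =
  chart_vector d ('D_w (chart_map d \o phi \o chart_inv c) (chart_map c p))
    (phi p).
Proof.
move=> sphi ac ad cp dp; apply/funext => f; rewrite /tangent_map.
case: asboolP => sf; last by rewrite chart_vector0.
have [cphi hphi] := sphi.
have [_ _ cK _ _] := manifold_chart ac; have [od _ dK _ _] := manifold_chart ad.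
rewrite !chart_vectorE//; last exact: smooth_fun_comp.
have dphi : differentiable (chart_map d \o phi \o chart_inv c) (chart_map c p).
  by have [+ _] := hphi c d ac ad 1%N; apply; exists p.
have e : (chart_map d \o phi \o chart_inv c) (chart_map c p) =
    chart_map d (phi p) by rewrite /= cK.
rewrite -e -derive_comp//; last by rewrite e; exact: differentiable_smooth_fun.
have nd : \forall q \near p, chart_dom d (phi q).
  by apply: cphi; exact: open_nbhs_nbhs.
apply: near_eq_derive.
by apply: filterS (near_chart_inv ac cp nd) => x [cx dx] /=; rewrite dK.
Qed.

Section TangentSpace.
Variables (R : realType) (n : nat) (M : manifold R n).

Lemma tangent_chart (c : chart R n M) (p : M) v :
  atlas c -> chart_dom c p -> tangent p v -> exists w, v = chart_vector c w p.
Proof.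
move=> ac cp [d [ad dp [w ->]]].
have e : tangent_map (fun q : M => q) (chart_vector d w p) =
    chart_vector d w p.
  apply/funext => f; rewrite /tangent_map; case: asboolP => // sf.
  by rewrite chart_vector0.
by rewrite -e (chart_vector_push w (smooth_map_id M) ad ac dp cp); eexists.
Qed.

Lemma tangent_linear (p : M) a u v :
  tangent p u -> tangent p v -> tangent p (a *: u + v).
Proof.
move=> [c [ac cp [w ->]]] /(tangent_chart ac cp) [w' ->].
by exists c; split=> //; exists (a *: w + w'); rewrite chart_vector_linear.
Qed.

Lemma tangent0 (p : M) : tangent p 0.
Proof.
have [c ac cp] := manifold_cover p; exists c; split=> //; exists 0.
apply/funext => f; have [sf|sf] := pselect (smooth_fun f).
  by rewrite chart_vectorE// derive0.
by rewrite chart_vector0.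
Qed.

Lemma tangentD (p : M) u v : tangent p u -> tangent p v -> tangent p (u + v).
Proof. by move=> tu tv; rewrite -[u]scale1r; exact: tangent_linear. Qed.

Lemma tangentZ (p : M) a u : tangent p u -> tangent p (a *: u).
Proof.
by move=> tu; rewrite -[_ *: _]addr0; apply: tangent_linear => //; exact: tangent0.
Qed.

Lemma tangentN (p : M) u : tangent p u -> tangent p (- u).
Proof. by move=> tu; rewrite -scaleN1r; exact: tangentZ. Qed.

Lemma tangent_sum (p : M) (I : Type) (s : seq I) (v : I -> operator M) :
  (forall i, tangent p (v i)) -> tangent p (\sum_(i <- s) v i).
Proof.
move=> tv; elim/big_ind : _ => //; [exact: tangent0|exact: tangentD].
Qed.

Lemma tangent_mapD m (N : manifold R m) (phi : M -> N) (u v : operator M) :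
  tangent_map phi (u + v) = tangent_map phi u + tangent_map phi v.
Proof.
apply/funext => f; change (tangent_map phi (u + v) f =
  tangent_map phi u f + tangent_map phi v f); rewrite /tangent_map.
by case: asboolP => // _; rewrite addr0.
Qed.

Lemma tangent_mapZ m (N : manifold R m) (phi : M -> N) a (u : operator M) :
  tangent_map phi (a *: u) = a *: tangent_map phi u.
Proof.
apply/funext => f; change (tangent_map phi (a *: u) f =
  a *: tangent_map phi u f); rewrite /tangent_map.
by case: asboolP => // _; rewrite scaler0.
Qed.

Lemma tangent_mapB m (N : manifold R m) (phi : M -> N) (u v : operator M) :
  tangent_map phi (u - v) = tangent_map phi u - tangent_map phi v.
Proof. by rewrite -scaleN1r tangent_mapD tangent_mapZ scaleN1r. Qed.

Lemma tangent_mapE m (N : manifold R m) (phi : M -> N) (u : operator M) f :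
  smooth_fun f -> tangent_map phi u f = u (f \o phi).
Proof. by move=> sf; rewrite /tangent_map asboolT. Qed.

Lemma tangent_map_id (p : M) v :
  tangent p v -> tangent_map (fun q : M => q) v = v.
Proof.
move=> tv; apply/funext => f; rewrite /tangent_map; case: asboolP => // sf.
by rewrite (tangent_non_smooth tv sf).
Qed.

Lemma tangent_eq (p : M) u v : tangent p u -> tangent p v ->
  (forall f, smooth_fun f -> u f = v f) -> u = v.
Proof.
move=> tu tv h; apply/funext => f; have [/h //|sf] := pselect (smooth_fun f).
by rewrite (tangent_non_smooth tu) ?(tangent_non_smooth tv).
Qed.

Lemma tangent_near (p : M) v (f g : M -> R) : tangent p v ->
  smooth_fun f -> smooth_fun g -> (\forall q \near p, f q = g q) -> v f = v g.
Proof.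
move=> [c [ac cp [w ->]]] sf sg fg; rewrite !chart_vectorE//.
apply: near_eq_derive.
by apply: filterS (near_chart_inv ac cp fg) => x [].
Qed.

Lemma tangent_fD (p : M) v (f g : M -> R) : tangent p v ->
  smooth_fun f -> smooth_fun g -> v (fun q => f q + g q) = v f + v g.
Proof.
move=> [c [ac cp [w ->]]] sf sg; rewrite !chart_vectorE//; last exact: smooth_funD.
have df := differentiable_smooth_fun ac cp sf.
have dg := differentiable_smooth_fun ac cp sg.
exact: (deriveD (diff_derivable df) (diff_derivable dg)).
Qed.

Lemma tangent_fM (p : M) v (f g : M -> R) : tangent p v ->
  smooth_fun f -> smooth_fun g ->
  v (fun q => f q * g q) = f p * v g + g p * v f.
Proof.
move=> [c [ac cp [w ->]]] sf sg; rewrite !chart_vectorE//; last exact: smooth_funM.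
have df := differentiable_smooth_fun ac cp sf.
have dg := differentiable_smooth_fun ac cp sg.
have [_ _ cK _ _] := manifold_chart ac.
have := @deriveM R _ (f \o chart_inv c) (g \o chart_inv c) (chart_map c p) w
  (diff_derivable df) (diff_derivable dg).
by rewrite /= cK.
Qed.

Lemma tangent_fcst (p : M) v (a : R) : tangent p v -> v (fun=> a) = 0.
Proof.
move=> [c [ac cp [w ->]]]; rewrite chart_vectorE//; last apply: smooth_fun_cst.
exact: derive_cst.
Qed.

Lemma tangent_fsum (p : M) v (I : Type) (s : seq I) (f : I -> M -> R) :
  tangent p v -> (forall i, smooth_fun (f i)) ->
  v (fun q => \sum_(i <- s) f i q) = \sum_(i <- s) v (f i).
Proof.
move=> tv sf; elim: s => [|i s IH].
  rewrite big_nil; under eq_fun do rewrite big_nil; exact: tangent_fcst tv.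
rewrite big_cons -IH -(tangent_fD tv (sf i)); last exact: smooth_fun_sum.
by under eq_fun do rewrite big_cons.
Qed.

Lemma tangent_fZ (p : M) v (a : R) (f : M -> R) :
  tangent p v -> smooth_fun f -> v (fun q => a * f q) = a * v f.
Proof.
move=> tv sf; rewrite (tangent_fM tv (@smooth_fun_cst _ _ _ a) sf).
by rewrite (tangent_fcst a tv) mulr0 addr0.
Qed.

End TangentSpace.

Lemma tangent_map_tangent (R : realType) m n (N : manifold R n)
    (M : manifold R m) (phi : N -> M) (p : N) v :
  smooth_map phi -> tangent p v -> tangent (phi p) (tangent_map phi v).
Proof.
move=> sphi [c [ac cp [w ->]]]; have [d ad dp] := manifold_cover (phi p).
exists d; split=> //; rewrite (chart_vector_push w sphi ac ad cp dp).
by eexists.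
Qed.

Lemma sum_operatorE (R : realType) n (M : manifold R n) (I : Type) (s : seq I)
    (v : I -> operator M) (f : M -> R) :
  (\sum_(i <- s) v i) f = \sum_(i <- s) v i f.
Proof.
elim: s => [|i s IH]; first by rewrite !big_nil.
rewrite !big_cons -IH; reflexivity.
Qed.

Section Sections.
Variables (R : realType) (m n : nat) (N : manifold R n) (M : manifold R m).
Variable phi : N -> M.

Lemma section_linear (f : N -> R) V V' : smooth_fun f ->
  section phi V -> section phi V' -> section phi (fun p => f p *: V p + V' p).
Proof.
move=> sf [tV sV] [tV' sV']; split=> [p|g sg]; first exact: tangent_linear.
apply: (@smooth_funD _ _ _ (fun p => f p * V p g) (fun p => V' p g)).
  by apply: smooth_funM => //; exact: sV.
exact: sV'.
Qed.

Lemma section0 : section phi (fun=> 0).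
Proof. by split=> [p|g sg]; [exact: tangent0|apply: smooth_fun_cst]. Qed.

Lemma sectionD V V' : section phi V -> section phi V' ->
  section phi (fun p => V p + V' p).
Proof.
move=> sV sV'; have := section_linear (@smooth_fun_cst _ _ N 1) sV sV'.
by under eq_fun do rewrite scale1r.
Qed.

Lemma sectionZ (f : N -> R) V : smooth_fun f -> section phi V ->
  section phi (fun p => f p *: V p).
Proof.
move=> sf sV; have := section_linear sf sV section0.
by under eq_fun do rewrite addr0.
Qed.

Lemma sectionN V : section phi V -> section phi (fun p => - V p).
Proof.
move=> sV; have := sectionZ (@smooth_fun_cst _ _ _ (-1)) sV.
by under eq_fun do rewrite scaleN1r.
Qed.

Lemma sectionB V V' : section phi V -> section phi V' ->
  section phi (fun p => V p - V' p).
Proof. by move=> sV /sectionN; exact: sectionD. Qed.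

Lemma section_sum (I : Type) (s : seq I) (V : I -> N -> operator M) :
  (forall i, section phi (V i)) -> section phi (fun p => \sum_(i <- s) V i p).
Proof.
move=> sV; elim: s => [|i s IH].
  by under eq_fun do rewrite big_nil; exact: section0.
by under eq_fun do rewrite big_cons; exact: sectionD.
Qed.

Lemma section_comp W : smooth_map phi -> vfield W ->
  section phi (fun p => W (phi p)).
Proof.
move=> sphi [tW sW]; split=> [p|g sg]; first exact: tW.
exact: (smooth_fun_comp sphi (sW g sg)).
Qed.

Lemma section_tangent_map X : smooth_map phi -> vfield X ->
  section phi (fun p => tangent_map phi (X p)).
Proof.
move=> sphi [tX sX]; split=> [p|g sg]; first exact: tangent_map_tangent.
under eq_fun do rewrite tangent_mapE//.
by apply: sX; exact: smooth_fun_comp.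
Qed.

End Sections.

Section Frames.
Variables (R : realType) (n : nat) (M : manifold R n).

(** Both the coordinates and the fields are defined on the whole manifold, so
    that the axioms of a connection, which concern global fields, apply to
    each term of an expansion. *)
Definition local_frame (q : M) (u : 'I_n -> M -> R)
    (E : 'I_n -> M -> operator M) : Prop :=
  [/\ (forall i, smooth_fun (u i)), (forall i, vfield (E i)) &
      (\forall q' \near q, forall v, tangent q' v ->
         v = \sum_i (v (u i) : R) *: E i q')].

(** The brackets of the fields of the frame vanish at [q]. *)
Definition commuting_at (q : M) (E : 'I_n -> M -> operator M) : Prop :=
  forall f i j, smooth_fun f ->
    E i q (fun q' => E j q' f) = E j q (fun q' => E i q' f).

Lemma local_frame_near (q : M) u E :
  local_frame q u E -> \forall q' \near q, local_frame q' u E.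
Proof. by move=> [su vE /near_join eE]; apply: filterS eE. Qed.

(** The coordinates of a chart and their partial derivatives, multiplied by a
    function that is 1 near [q]; the fields commute because second derivatives
    are symmetric. *)
Lemma coordinate_frame_exists (q : M) :
  exists u E, local_frame q u E /\ commuting_at q E.
Proof.
have [c ac cq] := manifold_cover q; have hc := manifold_chart ac.
have [_ oi iK _ _] := hc.
have [psi [K [spsi psi1 cK KA psi0]]] :=
  cutoff_in_chart ac cq (@filterT _ (nbhs q) _).
have Kc : K `<=` chart_dom c by move=> x /KA [].
have psiK (g : 'rV[R]_n -> R) : forall x, chart_dom c x -> ~ K x ->
    psi (chart_map c x) * g (chart_map c x) = 0.
  by move=> x cx /(psi0 _ cx) ->; rewrite mul0r.
have spsi_im : smooth_on (chart_im c) psi.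
  by move=> k; apply: Ck_on_sub (spsi k).
have sext (g : 'rV[R]_n -> R^o) : smooth_on (chart_im c) g ->
    smooth_fun (chart_ext c (fun x => psi x * g x)).
  move=> sg; apply: (smooth_chart_ext ac cK Kc (psiK g)) => k.
  exact: Ck_onM oi (spsi_im k) (sg k).
pose u i := chart_ext c (fun x => psi x * x 0 i).
pose E i x : operator M := if `[< chart_dom c x >] then
  psi (chart_map c x) *: chart_vector c (delta_mx 0 i) x else 0.
have EE i f : smooth_fun f -> (fun x => E i x f) = chart_ext c (fun x =>
    psi x * 'D_(delta_mx 0 i) (f \o chart_inv c : 'rV[R]_n -> R^o) x).
  move=> sf; apply/funext => x; rewrite /E /chart_ext.
  by case: asboolP => // cx; rewrite -chart_vectorE.
have sE i f : smooth_fun f -> smooth_fun (fun x => E i x f).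
  move=> sf; rewrite (EE _ _ sf).
  exact: (sext _ (fun k => (sf c ac k.+1).2 (delta_mx 0 i))).
have su i : smooth_fun (u i).
  apply: (sext (fun x : 'rV[R]_n => x 0 i : R^o)) => k.
  by apply: Ck_on_sub (Ck_on_id_coord R k i).
have vE i : vfield (E i).
  split=> [x|f]; last exact: sE.
  rewrite /E; case: asboolP => cx; last exact: tangent0.
  by apply: tangentZ; exists c; split=> //; eexists.
exists u, E; split; first split; [exact: su|exact: vE| |].
- apply: filterS (near_chart ac cq (near_join psi1)) => x [cx npsi] v tv.
  have psix := nbhs_singleton npsi.
  have [w ew] := tangent_chart ac cx tv.
  have uE i : v (u i) = w 0 i.
    rewrite ew chart_vectorE//.
    pose l (y : 'rV[R]_n) : 'rV[R]_n := y.
    have dl : derivable l (chart_map c x) w by exact: derivable_id.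
    have := derive_mx dl; rewrite [LHS]derive_id => /rowP/(_ i); rewrite mxE => ->.
    apply: near_eq_derive.
    have ni : nbhs (chart_map c x) (chart_im c).
      by apply: open_nbhs_nbhs; split=> //; exists x.
    apply: filterS2 ni npsi => y cy psiy /=; rewrite /u.
    by have [dy ey] := chart_imP hc cy; rewrite chart_extE// ey psiy mul1r.
  apply: (tangent_eq tv) => [|f sf].
    by apply: tangent_sum => i; apply: tangentZ; have [] := vE i.
  rewrite sum_operatorE ew chart_vectorE// {1}(row_sum_delta w).
  rewrite derive_sum_dir; last exact: differentiable_smooth_fun.
  apply: eq_bigr => i _; rewrite -ew uE /E asboolT// psix scale1r.
  by rewrite -[RHS]/(w 0 i *: chart_vector c (delta_mx 0 i) x f) chart_vectorE.
- move=> f i j sf.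
  have psiq := nbhs_singleton psi1.
  have Eq k g : smooth_fun g -> E k q g =
      'D_(delta_mx 0 k) (g \o chart_inv c : 'rV[R]_n -> R^o) (chart_map c q).
    by move=> sg; rewrite /E asboolT// psiq scale1r chart_vectorE.
  have EEq k l : E k q (fun x => E l x f) = 'D_(delta_mx 0 k)
      ('D_(delta_mx 0 l) (f \o chart_inv c : 'rV[R]_n -> R^o)) (chart_map c q).
    rewrite Eq; last exact: sE.
    apply: near_eq_derive.
    have ni : nbhs (chart_map c q) (chart_im c).
      by apply: open_nbhs_nbhs; split=> //; exists q.
    apply: filterS2 ni psi1 => y cy psiy /=.
    have [dy ey] := chart_imP hc cy.
    by rewrite (congr1 (@^~ (chart_inv c y)) (EE l f sf)) chart_extE// ey psiy mul1r.
  by rewrite !EEq; apply: (derive_sym _ _ oi) (sf c ac 2%N); exists q.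
Qed.

(** A combination of the fields of a frame with constant coefficients passes
    through any tangent vector. *)
Lemma extensionP (p : M) v : tangent p v ->
  vfield (extension p v) /\ extension p v p = v.
Proof.
move=> tv; have [u [E [[su vE eE] _]]] := coordinate_frame_exists p.
suff ex : exists X, vfield X /\ X p = v.
  have := xgetPex (fun=> 0) ex; exact.
exists (fun q => \sum_i (v (u i) : R) *: E i q); split.
  apply: section_sum => i.
  exact: (sectionZ (@smooth_fun_cst _ _ M (v (u i))) (vE i)).
by rewrite -(nbhs_singleton eE _ tv).
Qed.

Lemma vfield_fun (X : M -> operator M) (f : M -> R) :
  vfield X -> smooth_fun f -> smooth_fun (fun p => X p f : R).
Proof. by move=> [_]; apply. Qed.

Lemma vfield_tangent (X : M -> operator M) (p : M) :
  vfield X -> tangent p (X p).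
Proof. by case. Qed.

(** The product of two fields in a frame, with its part of order 2 separated
    from its part of order 1. *)
Lemma vfield_second (X Y : M -> operator M) (p : M) u E f :
  vfield X -> vfield Y -> local_frame p u E -> smooth_fun f ->
  X p (fun q => Y q f) = \sum_i (X p (fun q => Y q (u i)) * E i p f +
    \sum_j X p (u j) * Y p (u i) * E j p (fun q => E i q f)).
Proof.
move=> vX vY [su vE eE] sf; have tX := vfield_tangent p vX.
have sYu i : smooth_fun (fun q => Y q (u i) : R) by exact: vfield_fun.
have sEf i : smooth_fun (fun q => E i q f : R) by exact: vfield_fun.
rewrite (@tangent_near _ _ _ p _ _ (fun q => \sum_i Y q (u i) * E i q f) tX).
- rewrite (tangent_fsum _ tX); last by move=> i; exact: smooth_funM.
  apply: eq_bigr => i _; rewrite (tangent_fM tX)// addrC mulrC; congr (_ + _).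
  have /(congr1 (@^~ (fun q => E i q f))) := nbhs_singleton eE _ tX.
  rewrite sum_operatorE => ->; rewrite mulr_sumr; apply: eq_bigr => j _.
  by rewrite mulrA [X in X * _]mulrC.
- exact: vfield_fun.
- by apply: smooth_fun_sum => i; exact: smooth_funM.
- apply: filterS eE => q eq; rewrite {1}(eq _ (vfield_tangent q vY)).
  by rewrite sum_operatorE.
Qed.

(** The commutator is a tangent vector because its part of order 2 cancels,
    which is visible in a frame of commuting fields. *)
Lemma bracket_vfield (X Y : M -> operator M) :
  vfield X -> vfield Y -> vfield (bracket X Y).
Proof.
move=> vX vY; split=> [p|f sf]; last first.
  by apply: (@smooth_funB _ _ _ (fun p => X p (fun q => Y q f))
    (fun p => Y p (fun q => X q f))); apply: vfield_fun => //; exact: vfield_fun.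
have [u [E [F comm]]] := coordinate_frame_exists p; have [_ vE _] := F.
have tX := vfield_tangent p vX; have tY := vfield_tangent p vY.
suff -> : bracket X Y p = \sum_i
    (X p (fun q => Y q (u i)) - Y p (fun q => X q (u i)) : R) *: E i p.
  by apply: tangent_sum => i; apply: tangentZ; exact: vfield_tangent.
apply/funext => f; rewrite sum_operatorE /bracket.
have [sf|sf] := pselect (smooth_fun f); last first.
  have -> : (fun q => Y q f) = fun=> 0.
    by apply/funext => q; exact: tangent_non_smooth (vfield_tangent q vY) sf.
  have -> : (fun q => X q f) = fun=> 0.
    by apply/funext => q; exact: tangent_non_smooth (vfield_tangent q vX) sf.
  rewrite (tangent_fcst _ tX) (tangent_fcst _ tY) subrr big1// => i _.
  rewrite -[LHS]/(_ * E i p f).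
  by rewrite (tangent_non_smooth (vfield_tangent p (vE i)) sf) mulr0.
rewrite (vfield_second vX vY F sf) (vfield_second vY vX F sf).
rewrite !big_split /= opprD addrACA -sumrB [X in _ + X]addrC.
rewrite [X in - X + _]exchange_big /= [X in - X + _](eq_bigr (fun i =>
  \sum_j X p (u j) * Y p (u i) * E j p (fun q => E i q f))); last first.
  by move=> i _; apply: eq_bigr => j _; rewrite comm// [Y p _ * _]mulrC.
rewrite addNr addr0; apply: eq_bigr => i _.
by rewrite -mulrBl.
Qed.

End Frames.

(** * Connections along a map *)

Lemma operatorDE (R : realType) n (M : manifold R n) (u v : operator M) f :
  (u + v) f = u f + v f.
Proof. by []. Qed.

Lemma operatorNE (R : realType) n (M : manifold R n) (u : operator M) f :
  (- u) f = - u f.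
Proof. by []. Qed.

Lemma operatorZE (R : realType) n (M : manifold R n) (a : R) (u : operator M) f :
  (a *: u) f = a * u f.
Proof. by []. Qed.

Definition operatorE := (operatorDE, operatorNE, operatorZE).

Section Tensoriality.
Variables (R : realType) (m n : nat) (N : manifold R n) (M : manifold R m).
Variable phi : N -> M.
Hypothesis hphi : smooth_map phi.

Lemma section_expand (p : N) u E V :
  local_frame (phi p) u E -> section phi V ->
  \forall q \near p, V q = \sum_i (V q (u i) : R) *: E i (phi q).
Proof.
move=> [_ _ eE] [tV _]; have [cphi _] := hphi.
have h : \forall q \near p, forall v, tangent (phi q) v ->
    v = \sum_i (v (u i) : R) *: E i (phi q) := cphi p _ eE.
by apply: filterS h => q; apply; exact: tV.
Qed.

(** Multiplying by a bump function reduces any section to its local expansion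
    in a frame, so a rule that is linear over the smooth functions only sees
    the value of the section at the point. *)
Lemma tensorial_expand (W : lmodType R) (T : (N -> operator M) -> W)
    (p : N) u E V :
  (forall V V', section phi V -> section phi V' ->
     T (fun q => V q + V' q) = T V + T V') ->
  (forall f V, smooth_fun f -> section phi V ->
     T (fun q => f q *: V q) = f p *: T V) ->
  local_frame (phi p) u E -> section phi V ->
  T V = \sum_i (V p (u i) : R) *: T (fun q => E i (phi q)).
Proof.
move=> TD TZ F sV; have [su vE _] := F.
have [psi [spsi psi1 psi0]] := smooth_bump_fun (section_expand F sV).
have sVu i : smooth_fun (fun q => V q (u i) : R) by have [_] := sV; apply.
have sE i : section phi (fun q => E i (phi q)) by exact: section_comp.
have T0 : T (fun=> 0) = 0.
  have := TZ (fun=> 0) (fun=> 0) (@smooth_fun_cst _ _ _ 0) (@section0 _ _ _ _ _ _).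
  by under [in LHS]eq_fun do rewrite scaler0; rewrite scale0r.
have Tsum (s : seq 'I_m) (G : 'I_m -> N -> operator M) :
    (forall i, section phi (G i)) ->
    T (fun q => \sum_(i <- s) G i q) = \sum_(i <- s) T (G i).
  move=> sG; elim: s => [|i s IH].
    by rewrite big_nil -[RHS]T0; congr T; apply/funext => q; rewrite big_nil.
  rewrite big_cons -IH -TD//; last exact: section_sum.
  by congr T; apply/funext => q; rewrite big_cons.
rewrite -[LHS]scale1r -(nbhs_singleton psi1) -TZ//.
have -> : (fun q => psi q *: V q) =
    fun q => \sum_i (psi q * V q (u i)) *: E i (phi q).
  apply/funext => q.
  have [e|/psi0 ->] := pselect (V q = \sum_i (V q (u i) : R) *: E i (phi q)).
    by rewrite {1}e scaler_sumr; apply: eq_bigr => i _; rewrite scalerA.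
  by rewrite scale0r big1// => i _; rewrite mul0r scale0r.
rewrite (Tsum _ (fun i q => (psi q * V q (u i)) *: E i (phi q))); last first.
  by move=> i; apply: sectionZ (sE i); exact: smooth_funM.
apply: eq_bigr => i _.
rewrite (TZ (fun q => psi q * V q (u i)))//; last exact: smooth_funM.
by rewrite (nbhs_singleton psi1) mul1r.
Qed.

End Tensoriality.

Section ConnectionAlong.
Variables (R : realType) (m n : nat) (N : manifold R n) (M : manifold R m).
Variables (phi : N -> M)
  (D : (N -> operator N) -> (N -> operator M) -> (N -> operator M)).
Hypotheses (hphi : smooth_map phi) (hD : connection_along phi D).

Lemma conn_section X V : vfield X -> section phi V -> section phi (D X V).
Proof. by have [h _ _ _] := hD; exact: h. Qed.

Lemma connDl X X' V : vfield X -> vfield X' -> section phi V ->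
  D (fun p => X p + X' p) V = fun p => D X V p + D X' V p.
Proof.
move=> vX vX' sV; have [_ h _ _] := hD.
have := h (fun=> 1) X X' V (@smooth_fun_cst _ _ _ 1) vX vX' sV.
under eq_fun do rewrite scale1r; move=> ->.
by apply/funext => p; rewrite scale1r.
Qed.

Lemma conn0l V : section phi V -> D (fun=> 0) V = fun=> 0.
Proof.
move=> sV; have [_ h _ _] := hD.
have v0 := section0 (fun p : N => p).
have := h (fun=> -1) (fun=> 0) (fun=> 0) V (@smooth_fun_cst _ _ _ (-1)) v0 v0 sV.
under eq_fun do rewrite scaler0 addr0; move=> ->.
by apply/funext => p; rewrite scaleN1r addNr.
Qed.

Lemma connZl f X V : smooth_fun f -> vfield X -> section phi V ->
  D (fun p => f p *: X p) V = fun p => f p *: D X V p.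
Proof.
move=> sf vX sV; have [_ h _ _] := hD.
have v0 := section0 (fun p : N => p).
have := h f X (fun=> 0) V sf vX v0 sV; rewrite conn0l//.
under eq_fun do rewrite addr0; move=> ->.
by apply/funext => p; rewrite addr0.
Qed.

Lemma connDr X V V' : vfield X -> section phi V -> section phi V' ->
  D X (fun p => V p + V' p) = fun p => D X V p + D X V' p.
Proof. by have [_ _ h _] := hD; exact: h. Qed.

Lemma conn_leibniz f X V : smooth_fun f -> vfield X -> section phi V ->
  D X (fun p => f p *: V p) =
    fun p => (X p f : R) *: V p + f p *: D X V p.
Proof. by have [_ _ _ h] := hD; exact: h. Qed.

Lemma conn0r X : vfield X -> D X (fun=> 0) = fun=> 0.
Proof.
move=> vX; have := conn_leibniz (@smooth_fun_cst _ _ N 0) vX (section0 phi).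
under eq_fun do rewrite scaler0; move=> ->.
by apply/funext => p; rewrite scaler0 scale0r addr0.
Qed.

Lemma conn_sumr X (I : Type) (s : seq I) (V : I -> N -> operator M) :
  vfield X -> (forall i, section phi (V i)) ->
  D X (fun p => \sum_(i <- s) V i p) = fun p => \sum_(i <- s) D X (V i) p.
Proof.
move=> vX sV; elim: s => [|i s IH].
  under eq_fun do rewrite big_nil; rewrite conn0r//.
  by apply/funext => p; rewrite big_nil.
under eq_fun do rewrite big_cons; rewrite connDr//; last exact: section_sum.
by rewrite IH; apply/funext => p; rewrite big_cons.
Qed.

(** A connection is a local operator in its second argument: compare the
    Leibniz rules for the products of the two sections with a bump function
    supported where they agree. *)
Lemma conn_near X V V' p : vfield X -> section phi V -> section phi V' ->
  (\forall q \near p, V q = V' q) -> D X V p = D X V' p.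
Proof.
move=> vX sV sV' e; have [psi [spsi psi1 psi0]] := smooth_bump_fun e.
have eVV' : (fun q => psi q *: V q) = fun q => psi q *: V' q.
  apply/funext => q; have [->//|/psi0 ->] := pselect (V q = V' q).
  by rewrite !scale0r.
have := congr1 (fun W => D X W p) eVV'.
rewrite !conn_leibniz// (nbhs_singleton psi1) !scale1r (nbhs_singleton e).
by move/addrI.
Qed.

Lemma conn_expandl X V p u E : vfield X -> section phi V ->
  local_frame p u E ->
  D X V p = \sum_i (X p (u i) : R) *: D (E i) V p.
Proof.
move=> vX sV F.
apply: (tensorial_expand (smooth_map_id N) (T := fun X => D X V p) _ _ F vX).
- by move=> Y Y' vY vY'; rewrite connDl.
- by move=> f Y sf vY; rewrite connZl.
Qed.

Lemma conn_pointwise X X' V p : vfield X -> vfield X' -> section phi V ->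
  X p = X' p -> D X V p = D X' V p.
Proof.
move=> vX vX' sV e; have [u [E [F _]]] := coordinate_frame_exists p.
by rewrite (conn_expandl vX sV F) (conn_expandl vX' sV F) e.
Qed.

Definition curvature_along X Y V : N -> operator M := fun p =>
  D X (D Y V) p - D Y (D X V) p - D (bracket X Y) V p.

Lemma curvature_alongD X Y V V' p : vfield X -> vfield Y ->
  section phi V -> section phi V' ->
  curvature_along X Y (fun q => V q + V' q) p =
    curvature_along X Y V p + curvature_along X Y V' p.
Proof.
move=> vX vY sV sV'; have vXY := bracket_vfield vX vY.
rewrite /curvature_along !connDr//; try exact: conn_section.
by apply/funext => g; rewrite !operatorE; ring.
Qed.

(** The first derivatives of [f] produced by the Leibniz rule cancel by
    symmetry in [X] and [Y], and its second derivatives against the bracket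
    term. *)
Lemma curvature_alongZ X Y f V p : vfield X -> vfield Y ->
  smooth_fun f -> section phi V ->
  curvature_along X Y (fun q => f q *: V q) p = f p *: curvature_along X Y V p.
Proof.
move=> vX vY sf sV; have vXY := bracket_vfield vX vY.
have sDX := conn_section vX sV; have sDY := conn_section vY sV.
have sXf : smooth_fun (fun q => X q f : R) by exact: vfield_fun.
have sYf : smooth_fun (fun q => Y q f : R) by exact: vfield_fun.
rewrite /curvature_along !conn_leibniz//.
rewrite connDr//; [|exact: sectionZ..].
rewrite connDr//; [|exact: sectionZ..].
rewrite !conn_leibniz//.
by apply/funext => g; rewrite !operatorE [bracket X Y p f]/bracket; ring.
Qed.

Lemma curvature_along_expand X Y V p u E : vfield X -> vfield Y ->
  section phi V -> local_frame (phi p) u E ->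
  curvature_along X Y V p =
    \sum_l (V p (u l) : R) *: curvature_along X Y (fun q => E l (phi q)) p.
Proof.
move=> vX vY sV F.
apply: (tensorial_expand hphi (T := fun V => curvature_along X Y V p) _ _ F sV).
- by move=> W W' sW sW'; rewrite curvature_alongD.
- by move=> f W sf sW; rewrite curvature_alongZ.
Qed.

End ConnectionAlong.

(** * The curvature of a pulled back connection *)

Section PullbackCurvature.
Variables (R : realType) (m n : nat) (N : manifold R n) (M : manifold R m).
Variables (phi : N -> M) (D : operation M)
  (D' : (N -> operator N) -> (N -> operator M) -> (N -> operator M)).
Hypotheses (hphi : smooth_map phi) (hD : connection D)
  (hD' : pullback_connection phi D D').

Let hD'c : connection_along phi D' := hD'.1.

Lemma smooth_frame_coord (u : 'I_m -> M -> R) (E : 'I_m -> M -> operator M) p i :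
  local_frame (phi p) u E -> smooth_fun (fun q => u i (phi q)).
Proof. by move=> [su _ _]; exact: (smooth_fun_comp hphi (su i)). Qed.

Lemma pullback_conn_expand X W p u E : vfield X -> vfield W ->
  local_frame (phi p) u E ->
  D' X (fun q => W (phi q)) p =
    \sum_j (X p (fun q => u j (phi q)) : R) *: D (E j) W (phi p).
Proof.
move=> vX vW F; have [su vE _] := F.
have tX : tangent (phi p) (tangent_map phi (X p)).
  by apply: tangent_map_tangent => //; exact: vfield_tangent.
have [vx ex] := extensionP tX.
rewrite hD'.2// (conn_expandl hD vx vW F) ex.
by apply: eq_bigr => j _; rewrite tangent_mapE.
Qed.

(** The section [D' Y (W \o phi)] is not the restriction of a field on [M],
    but near [p] it is a combination of such restrictions with smooth
    coefficients, so the Leibniz rule applies. *)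
Lemma pullback_conn2_expand X Y W p u E : vfield X -> vfield Y -> vfield W ->
  local_frame (phi p) u E ->
  let x j := (X p (fun q => u j (phi q)) : R) in
  let y j := (Y p (fun q => u j (phi q)) : R) in
  D' X (D' Y (fun q => W (phi q))) p =
    \sum_j (X p (fun q => Y q (fun q' => u j (phi q'))) : R) *:
      D (E j) W (phi p) +
    \sum_k \sum_j (x k * y j) *: D (E k) (D (E j) W) (phi p).
Proof.
move=> vX vY vW F x y; have [su vE _] := F.
have sW : section phi (fun q => W (phi q)) by exact: section_comp.
have vEW j : vfield (D (E j) W) by exact: (conn_section hD).
have sEW j : section phi (fun q => D (E j) W (phi q)) by exact: section_comp.
have sy j : smooth_fun (fun q => Y q (fun q' => u j (phi q')) : R).
  by apply: vfield_fun => //; exact: smooth_frame_coord F.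
have syE j : section phi (fun q =>
    (Y q (fun q' => u j (phi q')) : R) *: D (E j) W (phi q)).
  exact: (sectionZ (sy j) (sEW j)).
have [cphi _] := hphi.
have nF : \forall q \near p, local_frame (phi q) u E := cphi p _ (local_frame_near F).
have near_e : \forall q \near p, D' Y (fun q => W (phi q)) q =
    \sum_j (Y q (fun q' => u j (phi q')) : R) *: D (E j) W (phi q).
  by apply: filterS nF => q; exact: pullback_conn_expand.
rewrite (conn_near hD'c vX (conn_section hD'c vY sW) _ near_e); last exact: section_sum.
rewrite (conn_sumr hD'c _ vX syE) [in RHS]exchange_big -big_split /=.
apply: eq_bigr => j _; rewrite (conn_leibniz hD'c (sy j) vX (sEW j)).
congr (_ + _); rewrite (pullback_conn_expand vX (vEW j) F) scaler_sumr.
by apply: eq_bigr => k _; rewrite scalerA mulrC.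
Qed.

(** The curvature of a pulled back connection is the pullback of the
    curvature: the right-hand side involves [D] and the values of the fields
    and of the section at [p] only, and the fields enter by their 2 x 2 minors.
    The terms with derivatives of the coefficients cancel by the definition of
    the bracket, applied to the functions [u j \o phi]. *)
Lemma pullback_curvature_expand X Y V p u E : vfield X -> vfield Y ->
  section phi V -> local_frame (phi p) u E ->
  let x j := (X p (fun q => u j (phi q)) : R) in
  let y j := (Y p (fun q => u j (phi q)) : R) in
  curvature_along D' X Y V p = \sum_l (V p (u l) : R) *:
    \sum_k \sum_j (x k * y j - x j * y k) *: D (E k) (D (E j) (E l)) (phi p).
Proof.
move=> vX vY sV F x y; have [su vE _] := F.
rewrite (curvature_along_expand hphi hD'c vX vY sV F).
apply: eq_bigr => l _; congr (_ *: _); rewrite /curvature_along.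
rewrite (pullback_conn2_expand vX vY (vE l) F).
rewrite (pullback_conn2_expand vY vX (vE l) F).
rewrite (pullback_conn_expand (bracket_vfield vX vY) (vE l) F).
have regroup (a b c d e : operator M) :
    a + b - (c + d) - e = (a - c - e) + (b - d).
  by rewrite opprD addrACA [LHS]addrAC.
rewrite regroup -2!sumrB big1 => [|j _]; last first.
  by rewrite -!scalerBl /bracket subrr scale0r.
rewrite add0r -sumrB; apply: eq_bigr => k _.
rewrite -sumrB; apply: eq_bigr => j _.
by rewrite -scalerBl; congr (_ *: _); rewrite /x /y; ring.
Qed.

End PullbackCurvature.

Lemma connection_pullback_id (R : realType) n (M : manifold R n)
    (D : operation M) :
  connection D -> pullback_connection (fun p : M => p) D D.
Proof.
move=> hD; split=> // X W p vX vW; have tX := vfield_tangent p vX.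
rewrite (tangent_map_id tX); have [vx ex] := extensionP tX.
exact: (conn_pointwise hD).
Qed.

Section CurvatureAt.
Variables (R : realType) (n : nat) (M : manifold R n) (D : operation M).
Hypothesis hD : connection D.

Lemma curvature_at_expand p x y z u E :
  tangent p x -> tangent p y -> tangent p z -> local_frame p u E ->
  curvature_at D p x y z = \sum_l (z (u l) : R) *: \sum_k \sum_j
    ((x (u k) : R) * y (u j) - x (u j) * y (u k)) *: D (E k) (D (E j) (E l)) p.
Proof.
move=> /extensionP[vx ex] /extensionP[vy ey] /extensionP[vz ez] F.
have hI := connection_pullback_id hD.
have := pullback_curvature_expand (smooth_map_id M) hD hI vx vy vz F.
by rewrite ex ey ez.
Qed.

Lemma curvature_at_det p x y z a b c d :
  tangent p x -> tangent p y -> tangent p z ->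
  curvature_at D p (a *: x + b *: y) (c *: x + d *: y) z =
    (a * d - b * c) *: curvature_at D p x y z.
Proof.
move=> tx ty tz; have [u [E [F _]]] := coordinate_frame_exists p.
have tZ e : tangent p (e *: y) by exact: tangentZ.
rewrite !(curvature_at_expand _ _ _ F)//; try exact: (tangent_linear _ _ (tZ _)).
rewrite scaler_sumr; apply: eq_bigr => l _.
rewrite scalerA [_ * z _]mulrC -scalerA; congr (_ *: _).
rewrite scaler_sumr; apply: eq_bigr => k _.
rewrite scaler_sumr; apply: eq_bigr => j _.
by rewrite scalerA; congr (_ *: _); rewrite !operatorE; ring.
Qed.

Lemma curvature_at_tangent p x y z :
  tangent p x -> tangent p y -> tangent p z ->
  tangent p (curvature_at D p x y z).
Proof.
move=> tx ty tz; have [u [E [F _]]] := coordinate_frame_exists p.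
have [_ vE _] := F.
rewrite (curvature_at_expand tx ty tz F).
apply: tangent_sum => l; apply: tangentZ; apply: tangent_sum => k.
apply: tangent_sum => j; apply: tangentZ; apply: vfield_tangent.
exact: (conn_section hD (vE k) (conn_section hD (vE j) (vE l))).
Qed.

End CurvatureAt.

(** * Forms, and parallelism of the form along a map *)

Section Form2.
Variables (R : realType) (n : nat) (M : manifold R n) (Om : form2 M).
Hypothesis hOm : is_form2 Om.

Lemma form2_linearl p a u u' v : tangent p u -> tangent p u' -> tangent p v ->
  Om p (a *: u + u') v = a * Om p u v + Om p u' v.
Proof. by have [h _ _] := hOm; exact: h. Qed.

Lemma form2_anti p u v : tangent p u -> tangent p v -> Om p u v = - Om p v u.
Proof. by have [_ h _] := hOm; exact: h. Qed.

Lemma form2Dl p u u' v : tangent p u -> tangent p u' -> tangent p v ->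
  Om p (u + u') v = Om p u v + Om p u' v.
Proof. by move=> *; rewrite -[u]scale1r form2_linearl// mul1r scale1r. Qed.

Lemma form20l p v : tangent p v -> Om p 0 v = 0.
Proof.
move=> tv; have t0 := tangent0 p; have := form2_linearl (-1) t0 t0 tv.
by rewrite scaler0 addr0 mulN1r addNr.
Qed.

Lemma form2Zl p a u v : tangent p u -> tangent p v ->
  Om p (a *: u) v = a * Om p u v.
Proof.
move=> tu tv; rewrite -[a *: u]addr0 form2_linearl//; last exact: tangent0.
by rewrite form20l// addr0.
Qed.

Lemma form2Bl p u u' v : tangent p u -> tangent p u' -> tangent p v ->
  Om p (u - u') v = Om p u v - Om p u' v.
Proof.
move=> tu tu' tv; rewrite -scaleN1r form2Dl//; last exact: tangentZ.
by rewrite form2Zl// mulN1r.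
Qed.

Lemma form2_suml p (I : Type) (s : seq I) (u : I -> operator M) v :
  (forall i, tangent p (u i)) -> tangent p v ->
  Om p (\sum_(i <- s) u i) v = \sum_(i <- s) Om p (u i) v.
Proof.
move=> tu tv; elim: s => [|i s IH]; first by rewrite !big_nil form20l.
by rewrite !big_cons form2Dl ?IH//; exact: tangent_sum.
Qed.

Lemma form2_self p u : tangent p u -> Om p u u = 0.
Proof.
move=> tu; have := form2_anti tu tu => /eqP; rewrite -subr_eq0 opprK.
by rewrite -mulr2n mulrn_eq0 => /eqP.
Qed.

Lemma form2_det p x y a b c d : tangent p x -> tangent p y ->
  Om p (a *: x + b *: y) (c *: x + d *: y) = (a * d - b * c) * Om p x y.
Proof.
move=> tx ty; have tcd : tangent p (c *: x + d *: y).
  by apply: tangent_linear => //; exact: tangentZ.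
have L v w : tangent p v -> tangent p w -> Om p v (c *: x + d *: y) =
    c * Om p v x + d * Om p v y.
  move=> tv tw; rewrite form2_anti// form2_linearl//; last exact: tangentZ.
  rewrite form2Zl// (form2_anti tx tv) (form2_anti ty tv); ring.
rewrite form2_linearl//; last exact: tangentZ.
rewrite form2Zl// !(L _ x)// !form2_self// (form2_anti ty tx); ring.
Qed.

End Form2.

Section MetricCompatibility.
Variables (R : realType) (m n : nat) (N : manifold R n) (M : manifold R m).
Variables (Om : form2 M) (phi : N -> M) (D : operation M)
  (D' : (N -> operator N) -> (N -> operator M) -> (N -> operator M)).
Hypotheses (hphi : smooth_map phi) (hOm : is_form2 Om)
  (hD : symplectic_connection Om D) (hD' : pullback_connection phi D D').

Let hD'c : connection_along phi D' := hD'.1.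

Let pair V V' : N -> R := fun q => Om (phi q) (V q) (V' q).

Lemma section_tangent (V : N -> operator M) q :
  section phi V -> tangent (phi q) (V q).
Proof. by case. Qed.

Lemma section_fun (V : N -> operator M) f :
  section phi V -> smooth_fun f -> smooth_fun (fun q => V q f : R).
Proof. by move=> [_]; apply. Qed.

Lemma smooth_pair V V' : section phi V -> section phi V' ->
  smooth_fun (pair V V').
Proof.
move=> sV sV'; apply: smooth_fun_near => p.
have [u [E [F _]]] := coordinate_frame_exists (phi p); have [su vE _] := F.
have [_ _ sOm] := hOm.
exists (fun q => \sum_i V q (u i) * \sum_j
    V' q (u j) * - Om (phi q) (E j (phi q)) (E i (phi q))).
  apply: smooth_fun_sum => i; apply: smooth_funM; first exact: section_fun.
  apply: smooth_fun_sum => j; apply: smooth_funM; first exact: section_fun.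
  apply: (smooth_fun_comp hphi (f := fun q => - Om q (E j q) (E i q))).
  have := smooth_funM (@smooth_fun_cst _ _ M (-1)) (sOm _ _ (vE j) (vE i)).
  by under eq_fun do rewrite mulN1r.
apply: filterS2 (section_expand hphi F sV) (section_expand hphi F sV').
move=> q eV eV'; rewrite /pair.
have tE i : tangent (phi q) (E i (phi q)) by exact: vfield_tangent.
have tV' := section_tangent q sV'.
rewrite {1}eV form2_suml//; last by move=> i; exact: tangentZ.
apply: eq_bigr => i _; rewrite form2Zl//; congr (_ * _).
rewrite form2_anti// {1}eV' form2_suml//; last by move=> j; exact: tangentZ.
rewrite -sumrN; apply: eq_bigr => j _.
by rewrite form2Zl// mulrN.
Qed.

Let defect X V V' p : R^o :=
  X p (pair V V') - Om (phi p) (D' X V p) (V' p) - Om (phi p) (V p) (D' X V' p).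

Let defect_anti X V V' p : vfield X -> section phi V -> section phi V' ->
  defect X V V' p = - defect X V' V p.
Proof.
move=> vX sV sV'; have tV q := section_tangent q sV.
have tV' q := section_tangent q sV'.
have tDV := section_tangent p (conn_section hD'c vX sV).
have tDV' := section_tangent p (conn_section hD'c vX sV').
have e : pair V V' = fun q => -1 * pair V' V q.
  by apply/funext => q; rewrite /pair form2_anti// mulN1r.
rewrite /defect e (tangent_fZ _ (vfield_tangent p vX)); last exact: smooth_pair.
by rewrite (form2_anti hOm tDV (tV' p)) (form2_anti hOm (tV p) tDV'); ring.
Qed.

Let defect_expand X V V' p u E : vfield X -> section phi V -> section phi V' ->
  local_frame (phi p) u E ->
  defect X V V' p =
    \sum_i (V p (u i) : R) *: defect X (fun q => E i (phi q)) V' p.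
Proof.
move=> vX sV sV' F; have tX := vfield_tangent p vX.
have tV' q := section_tangent q sV'.
have tDV' := section_tangent p (conn_section hD'c vX sV').
apply: (tensorial_expand hphi (T := fun V => defect X V V' p) _ _ F sV).
- move=> W W' sW sW'; rewrite /defect (connDr hD'c)//.
  have tW q := section_tangent q sW; have tW2 q := section_tangent q sW'.
  have tDW := section_tangent p (conn_section hD'c vX sW).
  have tDW' := section_tangent p (conn_section hD'c vX sW').
  have -> : pair (fun q => W q + W' q) V' = fun q => pair W V' q + pair W' V' q.
    by apply/funext => q; rewrite /pair form2Dl.
  rewrite (tangent_fD tX); [|exact: smooth_pair..].
  rewrite !form2Dl//; ring.
- move=> f W sf sW; rewrite /defect (conn_leibniz hD'c)//.
  have tW q := section_tangent q sW.
  have tDW := section_tangent p (conn_section hD'c vX sW).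
  have -> : pair (fun q => f q *: W q) V' = fun q => f q * pair W V' q.
    by apply/funext => q; rewrite /pair form2Zl.
  rewrite (tangent_fM tX sf); last exact: smooth_pair.
  rewrite form2_linearl//; last exact: tangentZ.
  by rewrite !form2Zl// /pair /GRing.scale /=; ring.
Qed.

(** The failure of the rule is a tensor in the first section, and
    antisymmetric in the two sections, so it is enough to test it on sections
    restricted from [M]; there it vanishes because [D] is symplectic. *)
Lemma pullback_connection_symplectic X V V' p :
  vfield X -> section phi V -> section phi V' ->
  X p (fun q => Om (phi q) (V q) (V' q)) =
    Om (phi p) (D' X V p) (V' p) + Om (phi p) (V p) (D' X V' p).
Proof.
move=> vX sV sV'; suff h : defect X V V' p = 0.
  by apply/eqP; rewrite -subr_eq0 opprD addrA; apply/eqP.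
have [u [E [F _]]] := coordinate_frame_exists (phi p); have [_ vE _] := F.
have sE i : section phi (fun q => E i (phi q)) by exact: section_comp.
rewrite (defect_expand vX sV sV' F) big1// => i _.
rewrite defect_anti// (defect_expand vX sV' (sE i) F) big1 ?oppr0 ?scaler0// => j _.
have tX := tangent_map_tangent hphi (vfield_tangent p vX).
have [vx ex] := extensionP tX; have [_ _ hDOm] := hD; have [_ _ sOm] := hOm.
rewrite /defect !hD'.2//.
have -> : X p (pair (fun q => E j (phi q)) (fun q => E i (phi q))) =
    tangent_map phi (X p) (fun q => Om q (E j q) (E i q)).
  by rewrite tangent_mapE//; exact: sOm.
by rewrite -{1}ex hDOm// -addrA -opprD subrr scaler0.
Qed.

End MetricCompatibility.

(** * The Gauss equation *)

Section Gauss.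
Variables (R : realType) (m n : nat) (N : manifold R n) (M : manifold R m).
Variables (Om : form2 M) (phi : N -> M) (D : operation M)
  (D' : (N -> operator N) -> (N -> operator M) -> (N -> operator M))
  (Dbar : operation N).
Hypotheses (hphi : smooth_map phi) (hOm : is_form2 Om)
  (hD : symplectic_connection Om D) (hD' : pullback_connection phi D D')
  (hDbar : induced_connection phi Om D' Dbar).

Let hD'c : connection_along phi D' := hD'.1.
Let hDb : connection Dbar := hDbar.1.

Definition pushforward (Z : N -> operator N) : N -> operator M :=
  fun q => tangent_map phi (Z q).

Definition second_form (X Z : N -> operator N) : N -> operator M :=
  fun q => D' X (pushforward Z) q - pushforward (Dbar X Z) q.

Lemma section_push Z : vfield Z -> section phi (pushforward Z).
Proof. exact: section_tangent_map. Qed.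

Lemma section_second_form X Z : vfield X -> vfield Z ->
  section phi (second_form X Z).
Proof.
move=> vX vZ; apply: sectionB.
  exact: (conn_section hD'c vX (section_push vZ)).
exact/section_push/(conn_section hDb).
Qed.

Lemma second_form_normal X Y Z p : vfield X -> vfield Y -> vfield Z ->
  Om (phi p) (second_form X Y p) (pushforward Z p) = 0.
Proof.
by move=> vX vY vZ; apply: hDbar.2 => //; exact: vfield_tangent.
Qed.

(** Obtained by differentiating the orthogonality of the second fundamental
    form to [phi_*(TN)] along [W]; only the normal part of [D' W] of the
    tangential field survives. *)
Lemma second_form_derivative W X Y Z p :
  vfield W -> vfield X -> vfield Y -> vfield Z ->
  Om (phi p) (D' W (second_form X Y) p) (pushforward Z p) =
    Om (phi p) (second_form W Z p) (second_form X Y p).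
Proof.
move=> vW vX vY vZ; have sP := section_second_form vX vY.
have sPW := section_second_form vW vZ.
have sZ := section_push vZ; have vD := conn_section hDb vW vZ.
have := pullback_connection_symplectic hphi hOm hD hD' p vW sP sZ.
have -> : (fun q => Om (phi q) (second_form X Y q) (pushforward Z q)) = fun=> 0.
  by apply/funext => q; exact: second_form_normal.
rewrite (tangent_fcst _ (vfield_tangent p vW)).
have -> : D' W (pushforward Z) p = pushforward (Dbar W Z) p + second_form W Z p.
  by rewrite addrC subrK.
have tP := section_tangent p sP; have tPW := section_tangent p sPW.
have tD := section_tangent p (section_push vD).
rewrite [X in _ = _ + X](form2_anti hOm tP); last exact: tangentD.
rewrite (form2Dl hOm tD tPW tP) -[Om _ (pushforward _ p) _]opprK.
rewrite -(form2_anti hOm tP tD).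
rewrite second_form_normal// oppr0 add0r => /eqP.
by rewrite eq_sym subr_eq0 => /eqP.
Qed.

Lemma gauss_second_derivative X Y Z p : vfield X -> vfield Y -> vfield Z ->
  Om (phi p) (D' X (D' Y (pushforward Z)) p) (pushforward Z p) =
    Om (phi p) (pushforward (Dbar X (Dbar Y Z)) p) (pushforward Z p) +
    Om (phi p) (second_form X Z p) (second_form Y Z p).
Proof.
move=> vX vY vZ; have vD := conn_section hDb vY vZ.
have sD := section_push vD; have sP := section_second_form vY vZ.
have e : D' Y (pushforward Z) =
    fun q => pushforward (Dbar Y Z) q + second_form Y Z q.
  by apply/funext => q; rewrite /second_form addrC subrK.
rewrite e (connDr hD'c)//.
have -> : D' X (pushforward (Dbar Y Z)) p =
    pushforward (Dbar X (Dbar Y Z)) p + second_form X (Dbar Y Z) p.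
  by rewrite addrC subrK.
have tZ := section_tangent p (section_push vZ).
have t1 := section_tangent p (section_push (conn_section hDb vX vD)).
have t2 := section_tangent p (section_second_form vX vD).
have t3 := section_tangent p (conn_section hD'c vX sP).
rewrite (form2Dl hOm (tangentD t1 t2) t3 tZ) (form2Dl hOm t1 t2 tZ).
by rewrite second_form_normal// addr0 second_form_derivative.
Qed.

(** Exchanging [X] and [Y] exchanges the arguments of the correction term of
    [gauss_second_derivative]; as [Om] is antisymmetric, the difference of the
    two corrections is twice one of them.  The bracket term contributes its
    tangential part only. *)
Lemma gauss_equation X Y Z p : vfield X -> vfield Y -> vfield Z ->
  Om (phi p) (curvature_along D' X Y (pushforward Z) p) (pushforward Z p) =
    pullback_form phi Om p (curvature Dbar X Y Z p) (Z p) +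
    2 * Om (phi p) (second_form X Z p) (second_form Y Z p).
Proof.
move=> vX vY vZ; have vXY := bracket_vfield vX vY.
have sZ := section_push vZ.
have tZ := section_tangent p sZ.
have sDD U V : vfield U -> vfield V -> section phi (D' U (D' V (pushforward Z))).
  by move=> vU vV; exact: (conn_section hD'c vU (conn_section hD'c vV sZ)).
have vDD U V : vfield U -> vfield V -> vfield (Dbar U (Dbar V Z)).
  by move=> vU vV; exact: (conn_section hDb vU (conn_section hDb vV vZ)).
have t1 := section_tangent p (sDD _ _ vX vY).
have t2 := section_tangent p (sDD _ _ vY vX).
have t3 := section_tangent p (conn_section hD'c vXY sZ).
have t12 := tangentD t1 (tangentN t2).
have u1 := section_tangent p (section_push (vDD _ _ vX vY)).
have u2 := section_tangent p (section_push (vDD _ _ vY vX)).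
have u3 := section_tangent p (section_push (conn_section hDb vXY vZ)).
have u12 := tangentD u1 (tangentN u2).
rewrite /curvature_along (form2Bl hOm t12 t3 tZ) (form2Bl hOm t1 t2 tZ).
rewrite !gauss_second_derivative//.
have e3 : D' (bracket X Y) (pushforward Z) p =
    pushforward (Dbar (bracket X Y) Z) p + second_form (bracket X Y) Z p.
  by rewrite addrC subrK.
have v3 := section_tangent p (section_second_form vXY vZ).
rewrite e3 (form2Dl hOm u3 v3 tZ) second_form_normal// addr0.
have ec : tangent_map phi (curvature Dbar X Y Z p) =
    pushforward (Dbar X (Dbar Y Z)) p - pushforward (Dbar Y (Dbar X Z)) p -
      pushforward (Dbar (bracket X Y) Z) p.
  by rewrite /curvature !tangent_mapB.
rewrite /pullback_form ec (form2Bl hOm u12 u3 tZ) (form2Bl hOm u1 u2 tZ).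
have w1 := section_tangent p (section_second_form vX vZ).
have w2 := section_tangent p (section_second_form vY vZ).
by rewrite (form2_anti hOm w2 w1); ring.
Qed.

End Gauss.

(** * Independence of the basis of a plane *)

Section Planes.
Variables (R : realType) (n : nat) (M : manifold R n).
Implicit Types x y : operator M.

(** If [x] and [y] were dependent, [L] would be contained in a line. *)
Lemma span2_basis (L : set (operator M)) x y :
  (exists x0 y0, plane_basis L x0 y0) ->
  L = span2 x y -> plane_basis L x y.
Proof.
move=> [x0 [y0 [ind e0]]] e; split=> // a b ab0.
have not_line v : ~ (forall w, L w -> exists s, w = s *: v).
  move=> hv.
  have [s es] : exists s, x0 = s *: v.
    by apply: hv; rewrite e0; exists 1, 0; rewrite scale1r scale0r addr0.
  have [t et] : exists t, y0 = t *: v.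
    by apply: hv; rewrite e0; exists 0, 1; rewrite scale1r scale0r add0r.
  have [_ /eqP] : t = 0 /\ - s = 0.
    apply: (ind t (- s)); rewrite es et !scalerA -scalerDl.
    by rewrite (_ : _ + _ = 0) ?scale0r//; ring.
  rewrite oppr_eq0 => /eqP s0; have [/eqP] : (1 : R) = 0 /\ (0 : R) = 0.
    by apply: (ind 1 0); rewrite es s0 !scale0r scaler0 addr0.
  by rewrite oner_eq0.
have [->|a0] := eqVneq a 0; first have [->//|b0] := eqVneq b 0.
  case: (not_line x) => w; rewrite e => -[c [d ->]]; exists (c - d * a / b).
  have -> : y = - (a / b) *: x.
    apply: (scalerI b0); rewrite scalerA mulrN [b * _]mulrC divfK// scaleNr.
    by apply/eqP; rewrite -addr_eq0 addrC ab0.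
  by rewrite scalerA -scalerDl mulrN mulrA.
case: (not_line y) => w; rewrite e => -[c [d ->]]; exists (d - c * b / a).
have -> : x = - (b / a) *: y.
  apply: (scalerI a0); rewrite scalerA mulrN [a * _]mulrC divfK// scaleNr.
  by apply/eqP; rewrite -addr_eq0 ab0.
by rewrite scalerA -scalerDl mulrN mulrA addrC.
Qed.

Lemma basis_change_det (L : set (operator M)) x y x0 y0 a b c d :
  plane_basis L x y -> plane_basis L x0 y0 ->
  x = a *: x0 + b *: y0 -> y = c *: x0 + d *: y0 -> a * d - b * c != 0.
Proof.
move=> [ind _] [ind0 _] ex ey; apply/eqP => det.
have [d0 /eqP b0] : d = 0 /\ - b = 0.
  apply: (ind _ _); rewrite ex ey !scalerDr !scalerA addrACA -!scalerDl.
  rewrite (_ : d * a + _ = 0); last by rewrite -det; ring.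
  by rewrite (_ : d * b + _ = 0) ?scale0r ?addr0//; ring.
have [c0 /eqP a0] : c = 0 /\ - a = 0.
  apply: (ind _ _); rewrite ex ey !scalerDr !scalerA addrACA -!scalerDl.
  rewrite (_ : c * b + _ = 0); last by rewrite -[RHS]oppr0 -det; ring.
  by rewrite (_ : c * a + _ = 0) ?scale0r ?addr0//; ring.
move: a0 b0; rewrite !oppr_eq0 => /eqP a0 /eqP b0.
have [/eqP] : (1 : R) = 0 /\ (0 : R) = 0.
  by apply: (ind 1 0); rewrite ex a0 b0 !scale0r !addr0 scaler0.
by rewrite oner_eq0.
Qed.

(** A change of basis multiplies the numerator and the denominator by its
    determinant. *)
Lemma sympl_curvature_basis (Om : form2 M) (D : operation M) p
    (L : set (operator M)) x y z :
  is_form2 Om -> connection D -> L `<=` tangent p -> plane_basis L x y ->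
  tangent p z ->
  sympl_curvature Om D p L z = Om p (curvature_at D p x y z) z / Om p x y.
Proof.
move=> hOm hD Lt bxy tz; rewrite /sympl_curvature.
set w := xget _ _.
have bw : plane_basis L w.1 w.2.
  by apply: (@xgetPex _ (0, 0) [set b | plane_basis L b.1 b.2]); exists (x, y).
have [_ eL] := bxy; have [_ eLw] := bw.
have in_span (u v : operator M) : span2 u v u /\ span2 u v v.
  by split; [exists 1, 0|exists 0, 1]; rewrite scale1r scale0r ?addr0 ?add0r.
have [[Lx Ly] [Lw1 Lw2]] : (L x /\ L y) /\ (L w.1 /\ L w.2).
  by split; [rewrite eL|rewrite eLw]; exact: in_span.
have tx := Lt _ Lx; have ty := Lt _ Ly.
have tw1 := Lt _ Lw1; have tw2 := Lt _ Lw2.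
move: Lw1 Lw2; rewrite {1 2}eL => -[a [b e1]] [c [d e2]].
have det := basis_change_det bw bxy e1 e2.
rewrite e1 e2 (curvature_at_det hD)// (form2_det hOm)//.
rewrite (form2Zl hOm)//; last exact: curvature_at_tangent.
by rewrite -mulf_div divff// mul1r.
Qed.

End Planes.

(** * The comparison of the symplectic curvatures *)

Theorem lemma6p1 (R : realType) (m n : nat)
    (M : manifold R m) (N : manifold R n)
    (Om : form2 M) (phi : N -> M) (D : operation M)
    (Dphi : (N -> operator N) -> (N -> operator M) -> (N -> operator M))
    (Dbar : operation N)
    (hOm : symplectic_form Om)
    (hphi : smooth_map phi)
    (hphiOm : symplectic_form (pullback_form phi Om))
    (hD : symplectic_connection Om D)
    (hDphi : pullback_connection phi D Dphi)
    (hDbar : induced_connection phi Om Dphi Dbar)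
    (p : N) (L : set (operator N))
    (hL : symplectic_plane (pullback_form phi Om) p L)
    (X Y Z : operator N) (hXY : L = span2 X Y) (hZ : L Z) :
  let Pi := second_fundamental_form phi Dphi Dbar p in
  sympl_curvature Om D (phi p) (tangent_map phi @` L) (tangent_map phi Z) =
  sympl_curvature (pullback_form phi Om) Dbar p L Z
  + 2 * Om (phi p) (Pi X Z) (Pi Y Z) / pullback_form phi Om p X Y.
Proof.
move=> Pi; have [Lt Lb _] := hL.
have bXY := span2_basis Lb hXY.
have LX : L X by rewrite hXY; exists 1, 0; rewrite scale1r scale0r addr0.
have LY : L Y by rewrite hXY; exists 0, 1; rewrite scale1r scale0r add0r.
have tX := Lt _ LX; have tY := Lt _ LY; have tZ := Lt _ hZ.
have [fOm _ _] := hOm; have [fphiOm nd _] := hphiOm.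
have tphi v : tangent p v -> tangent (phi p) (tangent_map phi v).
  exact: tangent_map_tangent.
have [cD _ _] := hD; have cDb := hDbar.1.
(* the differential is injective because the pulled back form is
   nondegenerate *)
have inj v : tangent p v -> tangent_map phi v = 0 -> v = 0.
  move=> tv v0; apply: (nd p) => // w tw.
  by rewrite /pullback_form v0 form20l//; exact: tphi.
have bTXY : plane_basis (tangent_map phi @` L) (tangent_map phi X)
    (tangent_map phi Y).
  split=> [a b|].
    rewrite -!tangent_mapZ -tangent_mapD => /inj h; apply: bXY.1; apply: h.
    by apply: tangent_linear => //; exact: tangentZ.
  rewrite hXY; apply/seteqP; split=> [_ [_ [a [b ->]] <-]|_ [a [b ->]]].
    by exists a, b; rewrite tangent_mapD !tangent_mapZ.
  by exists (a *: X + b *: Y); [exists a, b|rewrite tangent_mapD !tangent_mapZ].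
have TLt : tangent_map phi @` L `<=` tangent (phi p).
  by move=> _ [v Lv <-]; exact/tphi/Lt.
rewrite (sympl_curvature_basis fOm cD TLt bTXY (tphi _ tZ)).
rewrite (sympl_curvature_basis fphiOm cDb Lt bXY tZ).
rewrite -mulrDl; congr (_ / _).
have [vX eX] := extensionP tX; have [vY eY] := extensionP tY.
have [vZ eZ] := extensionP tZ.
have := gauss_equation hphi fOm hD hDphi hDbar p vX vY vZ.
rewrite /pushforward eZ => <-; congr (Om _ _ _).
(* the two curvatures have the same expansion in a frame at [phi p] *)
have [u [E [F _]]] := coordinate_frame_exists (phi p).
rewrite (curvature_at_expand cD (tphi _ tX) (tphi _ tY) (tphi _ tZ) F).
have sZ := section_tangent_map hphi vZ.
rewrite (pullback_curvature_expand hphi cD hDphi vX vY sZ F) eX eY eZ.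
have [su _ _] := F.
apply: eq_bigr => l _; congr (_ *: _).
apply: eq_bigr => k _; apply: eq_bigr => j _; congr (_ *: _).
by rewrite !tangent_mapE.
Qed.
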